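(* Assume the limited principle of omniscience $\mathsf{LPO}$, and assume that for all sets $A$ and $B$ which both have the strong Myhill property, $A + B$ has the Myhill property or $A \times B$ has the Myhill property. Then excluded middle holds (i.e. $p \vee \neg p$ for every $p \in \Omega$).
   Context: The statement is to be proved constructively (intuitionistic set theory with powersets and $\mathbb{N}$, equivalently the internal logic of a topos with natural numbers object; neither excluded middle nor choice is assumed). $\Omega = \mathcal{P}(1)$ is the set of truth values; $+$ is disjoint union. $\mathsf{LPO}$: for every $p \in 2^{\mathbb{N}}$, either $p$ is the constant $0$ sequence or there exists $n$ with $p_n = 1$. A set $X$ has the Myhill property if for all subsets $A, B \subseteq X$: if there are injections $f, g : X \to X$ with $A = f^{-1}(B)$ and $B = g^{-1}(A)$, then there is a bijection $h : X \to X$ which restricts to a bijection between $A$ and $B$. For injections $f, g : X \to X$ and $m \in \mathbb{Z}$, let $R^{f,g}_m \subseteq X \times X$ be the partial injection $f \circ (g \circ f)^m$: for $m \ge 0$, $(x,y) \in R^{f,g}_m$ iff $y = f((g\circ f)^m(x))$; for $m < 0$, $(x,y) \in R^{f,g}_m$ iff $x = g((f \circ g)^{-m-1}(y))$. A set $X$ has the strong Myhill property if for every pair of injections $f, g : X \to X$ there is a bijection $h : X \to X$ whose graph is contained in $\bigcup_{m \in \mathbb{Z}} R^{f,g}_m$. *)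

(* Defs.v *)
(* The theorem is a statement *about* provability: a certain sentence is
   derivable in intuitionistic set theory.  It is not stated with Rocq's own
   [Prop] as the set of truth values, because "p \/ ~ p for every p : Prop"
   is one application of the axiom [classic] when that axiom is loaded, so the
   absence of excluded middle and choice would not be part of the claim.

   The theory is bounded intuitionistic Zermelo set theory: extensionality,
   pairing, union, power set, infinity and Delta_0-separation, over first-order
   intuitionistic logic with equality.  It is the set theory that corresponds
   to the internal logic of toposes with a natural numbers object.  It has no
   excluded middle, no choice, no replacement or collection, no foundation. *)

From Stdlib Require Import List.
Import ListNotations.

(** * First-order intuitionistic logic in the language of set theory *)

(* De Bruijn indices; variables are the only terms. *)
Inductive form : Type :=
| Mem (i j : nat)
| Eq  (i j : nat)
| Bot
| And (a b : form)
| Or  (a b : form)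
| Imp (a b : form)
| All (a : form)
| Ex  (a : form).

Definition up (r : nat -> nat) (n : nat) : nat :=
  match n with 0 => 0 | S k => S (r k) end.

Fixpoint rename (r : nat -> nat) (a : form) : form :=
  match a with
  | Mem i j => Mem (r i) (r j)
  | Eq i j => Eq (r i) (r j)
  | Bot => Bot
  | And a b => And (rename r a) (rename r b)
  | Or a b => Or (rename r a) (rename r b)
  | Imp a b => Imp (rename r a) (rename r b)
  | All a => All (rename (up r) a)
  | Ex a => Ex (rename (up r) a)
  end.

Definition inst (t : nat) (a : form) : form :=
  rename (fun n => match n with 0 => t | S k => k end) a.

(* Natural deduction with non-logical axioms [T].  The axioms may be open
   formulas; as they are available in every context, this amounts to taking
   their universal closures. *)
Inductive prv (T : form -> Prop) : list form -> form -> Prop :=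
| prv_ax G a : T a -> prv T G a
| prv_hyp G a : In a G -> prv T G a
| prv_botE G a : prv T G Bot -> prv T G a
| prv_andI G a b : prv T G a -> prv T G b -> prv T G (And a b)
| prv_andE1 G a b : prv T G (And a b) -> prv T G a
| prv_andE2 G a b : prv T G (And a b) -> prv T G b
| prv_orI1 G a b : prv T G a -> prv T G (Or a b)
| prv_orI2 G a b : prv T G b -> prv T G (Or a b)
| prv_orE G a b c :
    prv T G (Or a b) -> prv T (a :: G) c -> prv T (b :: G) c -> prv T G c
| prv_impI G a b : prv T (a :: G) b -> prv T G (Imp a b)
| prv_impE G a b : prv T G (Imp a b) -> prv T G a -> prv T G b
| prv_allI G a : prv T (map (rename S) G) a -> prv T G (All a)
| prv_allE G a t : prv T G (All a) -> prv T G (inst t a)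
| prv_exI G a t : prv T G (inst t a) -> prv T G (Ex a)
| prv_exE G a c :
    prv T G (Ex a) -> prv T (a :: map (rename S) G) (rename S c) -> prv T G c
| prv_eqI G t : prv T G (Eq t t)
| prv_eqE G a s t :
    prv T G (Eq s t) -> prv T G (inst s a) -> prv T G (inst t a).

(** * Formulas with named variables *)

(* A [fml] gives, for each number [d] of enclosing quantifiers, a formula in
   which a variable is designated by its level, counted from the outermost
   quantifier.  The quantifiers [all] and [ex] bind a Rocq variable to the
   level of the new variable; [mem] and [eq] translate levels to indices. *)
Definition var := nat.
Definition fml := nat -> form.

Definition mem (x y : var) : fml := fun d => Mem (d - S x) (d - S y).
Definition eq (x y : var) : fml := fun d => Eq (d - S x) (d - S y).
Definition bot : fml := fun _ => Bot.
Definition and (a b : fml) : fml := fun d => And (a d) (b d).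
Definition or (a b : fml) : fml := fun d => Or (a d) (b d).
Definition imp (a b : fml) : fml := fun d => Imp (a d) (b d).
Definition iff (a b : fml) : fml := and (imp a b) (imp b a).
Definition neg (a : fml) : fml := imp a bot.
Definition all (F : var -> fml) : fml := fun d => All (F d (S d)).
Definition ex (F : var -> fml) : fml := fun d => Ex (F d (S d)).

Definition sentence (a : fml) : form := a 0.

Declare Scope fml_scope.
Delimit Scope fml_scope with fml.
Bind Scope fml_scope with fml.

Notation "x ∈ y" := (mem x y) (at level 70, no associativity) : fml_scope.
Notation "x ≐ y" := (eq x y) (at level 70, no associativity) : fml_scope.
Notation "¬ a" := (neg a) (at level 75, right associativity) : fml_scope.
Notation "a ∧ b" := (and a b) (at level 80, right associativity) : fml_scope.
Notation "a ∨ b" := (or a b) (at level 85, right associativity) : fml_scope.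
Notation "a ⇒ b" := (imp a b) (at level 90, right associativity) : fml_scope.
Notation "a ⇔ b" := (iff a b) (at level 95, no associativity) : fml_scope.
Notation "∀ x .. y , a" := (all (fun x => .. (all (fun y => a)) ..))
  (at level 200, x binder, y binder, right associativity) : fml_scope.
Notation "∃ x .. y , a" := (ex (fun x => .. (ex (fun y => a)) ..))
  (at level 200, x binder, y binder, right associativity) : fml_scope.

Open Scope fml_scope.

Definition allin (A : var) (F : var -> fml) : fml := ∀ x, x ∈ A ⇒ F x.
Definition exin (A : var) (F : var -> fml) : fml := ∃ x, x ∈ A ∧ F x.

Notation "∀' x ∈ A , a" := (allin A (fun x => a))
  (at level 200, x name, A at level 69, right associativity) : fml_scope.
Notation "∃' x ∈ A , a" := (exin A (fun x => a))
  (at level 200, x name, A at level 69, right associativity) : fml_scope.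

(** * Set-theoretic notions *)

Definition Sub (x y : var) : fml := ∀ z, z ∈ x ⇒ z ∈ y.

Definition IsEmpty (x : var) : fml := ∀ z, ¬ z ∈ x.

(* o = 1 = {0} *)
Definition IsOne (o : var) : fml := ∀ z, z ∈ o ⇔ IsEmpty z.

(* t = 2 = {0, 1} *)
Definition IsTwo (t : var) : fml := ∀ z, z ∈ t ⇔ IsEmpty z ∨ IsOne z.

(* y = x ∪ {x} *)
Definition IsSucc (y x : var) : fml := ∀ z, z ∈ y ⇔ z ∈ x ∨ z ≐ x.

Definition Inductive_ (w : var) : fml :=
  (∃' e ∈ w, IsEmpty e) ∧ (∀' x ∈ w, ∃' y ∈ w, IsSucc y x).

(* w is the set of natural numbers, i.e. the least inductive set *)
Definition IsNat (w : var) : fml :=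
  Inductive_ w ∧ (∀ v, Inductive_ v ⇒ Sub w v).

(* z = {x, y} *)
Definition IsUPair (z x y : var) : fml := ∀ u, u ∈ z ⇔ u ≐ x ∨ u ≐ y.

(* z = (x, y) = {{x}, {x, y}} *)
Definition IsPair (z x y : var) : fml :=
  ∃ a b, IsUPair a x x ∧ IsUPair b x y ∧ IsUPair z a b.

(* (x, y) ∈ r *)
Definition Rel (r x y : var) : fml := ∃' z ∈ r, IsPair z x y.

(* P = A × B *)
Definition IsProd (P A B : var) : fml :=
  ∀ z, z ∈ P ⇔ (∃' a ∈ A, ∃' b ∈ B, IsPair z a b).

(* S = A + B = {0} × A ∪ {1} × B *)
Definition IsSum (S A B : var) : fml :=
  ∀ z, z ∈ S ⇔
    (∃' a ∈ A, ∃ i, IsEmpty i ∧ IsPair z i a) ∨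
    (∃' b ∈ B, ∃ i, IsOne i ∧ IsPair z i b).

(* Functions A -> B are identified with their graphs. *)
Definition IsFun (f A B : var) : fml :=
  (∀' z ∈ f, ∃' x ∈ A, ∃' y ∈ B, IsPair z x y) ∧
  (∀' x ∈ A, ∃ y, Rel f x y ∧ (∀ y', Rel f x y' ⇒ y' ≐ y)).

Definition IsInj (f A B : var) : fml :=
  IsFun f A B ∧ (∀ x x' y, Rel f x y ⇒ Rel f x' y ⇒ x ≐ x').

Definition IsBij (f A B : var) : fml :=
  IsInj f A B ∧ (∀' y ∈ B, ∃' x ∈ A, Rel f x y).

(* A = f^-1(B), for f : X -> X *)
Definition IsPreimage (A f X B : var) : fml :=
  ∀ x, x ∈ A ⇔ x ∈ X ∧ (∃' y ∈ B, Rel f x y).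

(* k is the restriction of the function h to A *)
Definition IsRestriction (k h A : var) : fml :=
  ∀ z, z ∈ k ⇔ z ∈ h ∧ (∃' x ∈ A, ∃ y, IsPair z x y).

(** * The Myhill properties *)

Definition Myhill (X : var) : fml :=
  ∀ A B, Sub A X ⇒ Sub B X ⇒
  ∀ f g, IsInj f X X ⇒ IsInj g X X ⇒
    IsPreimage A f X B ⇒ IsPreimage B g X A ⇒
    ∃ h, IsBij h X X ∧ (∃ k, IsRestriction k h A ∧ IsBij k A B).

(* v = g(f(u)) *)
Definition Comp (g f u v : var) : fml := ∃ m, Rel f u m ∧ Rel g m v.

(* y = (g ∘ f)^n (x) for f, g : X -> X and n in the set w of natural numbers;
   s is the sequence of iterates of g ∘ f starting at x. *)
Definition Iterate (w X g f n x y : var) : fml :=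
  ∃ s, IsFun s w X ∧
    (∃ e, IsEmpty e ∧ Rel s e x) ∧
    (∀' i ∈ w, ∀' j ∈ w, IsSucc j i ⇒
       ∀ u v, Rel s i u ⇒ Rel s j v ⇒ Comp g f u v) ∧
    Rel s n y.

(* (x, y) ∈ R_m for m = n >= 0:  y = f((g ∘ f)^n (x)) *)
Definition RNonneg (w X f g n x y : var) : fml :=
  ∃ z, Iterate w X g f n x z ∧ Rel f z y.

(* (x, y) ∈ R_m for m = - n - 1 < 0:  x = g((f ∘ g)^n (y)) *)
Definition RNeg (w X f g n x y : var) : fml :=
  ∃ z, Iterate w X f g n y z ∧ Rel g z x.

(* (x, y) belongs to the union of the R_m; an integer m is either a natural
   number n or - n - 1 for a natural number n. *)
Definition RUnion (w X f g x y : var) : fml :=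
  ∃' n ∈ w, RNonneg w X f g n x y ∨ RNeg w X f g n x y.

Definition StrongMyhill (X : var) : fml :=
  ∀ w, IsNat w ⇒
  ∀ f g, IsInj f X X ⇒ IsInj g X X ⇒
    ∃ h, IsBij h X X ∧ (∀ x y, Rel h x y ⇒ RUnion w X f g x y).

(** * Omniscience principles *)

Definition LPO : fml :=
  ∀ w t, IsNat w ⇒ IsTwo t ⇒
  ∀ p, IsFun p w t ⇒
    (∀' n ∈ w, ∃ e, IsEmpty e ∧ Rel p n e) ∨
    (∃' n ∈ w, ∃ o, IsOne o ∧ Rel p n o).

(* p ⊆ 1, regarded as a truth value, holds when 0 ∈ p *)
Definition Holds (p : var) : fml := ∃' e ∈ p, IsEmpty e.

Definition ExcludedMiddle : fml :=
  ∀ o, IsOne o ⇒ ∀ p, Sub p o ⇒ Holds p ∨ ¬ Holds p.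

(** * Bounded intuitionistic Zermelo set theory *)

(* Delta_0 formulas: all quantifiers are bounded by a variable. *)
Inductive bounded : form -> Prop :=
| bounded_mem i j : bounded (Mem i j)
| bounded_eq i j : bounded (Eq i j)
| bounded_bot : bounded Bot
| bounded_and a b : bounded a -> bounded b -> bounded (And a b)
| bounded_or a b : bounded a -> bounded b -> bounded (Or a b)
| bounded_imp a b : bounded a -> bounded b -> bounded (Imp a b)
| bounded_all j a : bounded a -> bounded (All (Imp (Mem 0 (S j)) a))
| bounded_ex j a : bounded a -> bounded (Ex (And (Mem 0 (S j)) a)).

Definition Extensionality : fml := ∀ x y, (∀ z, z ∈ x ⇔ z ∈ y) ⇒ x ≐ y.
Definition Pairing : fml := ∀ x y, ∃ z, IsUPair z x y.
Definition Union : fml := ∀ x, ∃ u, ∀ z, z ∈ u ⇔ (∃' y ∈ x, z ∈ y).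
Definition PowerSet : fml := ∀ x, ∃ p, ∀ z, z ∈ p ⇔ Sub z x.
Definition Infinity : fml := ∃ w, Inductive_ w.

(* ∀ x, ∃ y, ∀ z, z ∈ y ⇔ z ∈ x ∧ a.  In [a], index 0 is z, index 1 is x and
   the higher indices are parameters; [rename (up S)] makes room for y. *)
Definition Separation (a : form) : form :=
  let a' := rename (up S) a in
  All (Ex (All (And (Imp (Mem 0 1) (And (Mem 0 2) a'))
                    (Imp (And (Mem 0 2) a') (Mem 0 1))))).

Inductive BIZ : form -> Prop :=
| BIZ_extensionality : BIZ (sentence Extensionality)
| BIZ_pairing : BIZ (sentence Pairing)
| BIZ_union : BIZ (sentence Union)
| BIZ_powerset : BIZ (sentence PowerSet)
| BIZ_infinity : BIZ (sentence Infinity)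
| BIZ_separation a : bounded a -> BIZ (Separation a).

Definition provable (a : fml) : Prop := prv BIZ [] (sentence a).

(* Main.v *)
(* Let p be a subset of 1, A = ω and B = {x ∈ 2 | x = 0 or p holds}.  Both have
   the strong Myhill property: on ω, LPO makes the Cantor-Bernstein construction
   effective, with a bijection contained in the union of R_0 and R_{-1}; and
   every injection from B to B is surjective.  Each of X = A + B and X = A × B
   is a decidable disjoint union of a copy i(ω) of ω, a set q with at most one
   element which is inhabited iff p holds, and a rest.  The injection that maps
   i(n) to i(n+1) and q to i(0), and fixes the rest, reduces both of
   q ∪ i(odd numbers) and i(even numbers) to the other.  Given a bijection h
   from the first of these sets to the second, it is decidable for even n
   whether h^-1(i(n)) is in q, so by LPO it is decidable whether q is inhabited.

   This argument is carried out in a Kripke-Beth model whose worlds are the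
   contexts of the deduction system.  Forcing in this model coincides with
   derivability, so whatever is forced in all worlds is provable; and variables
   bound by the quantifiers of the object language become variables of Rocq. *)

Require Import Defs.
From Stdlib Require Import List Arith Lia Setoid Morphisms.
Import ListNotations.

(** * Renaming and fresh variables *)

Lemma up_ext r r' N : (forall n, n < N -> r n = r' n) ->
  forall n, n < N -> up r n = up r' n.
Proof. intros H [|n] L; simpl; trivial. rewrite H; lia. Qed.

Lemma rename_ext a : forall r r', (forall n, r n = r' n) -> rename r a = rename r' a.
Proof.
  induction a; intros r r' H; simpl; f_equal; auto.
  - apply IHa; intros [|n]; simpl; auto.
  - apply IHa; intros [|n]; simpl; auto.
Qed.

Lemma rename_comp a : forall r s,
  rename r (rename s a) = rename (fun n => r (s n)) a.
Proof.
  induction a; intros r s; simpl; f_equal; auto.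
  - rewrite IHa; apply rename_ext; intros [|n]; reflexivity.
  - rewrite IHa; apply rename_ext; intros [|n]; reflexivity.
Qed.

Lemma rename_id a r : (forall n, r n = n) -> rename r a = a.
Proof.
  revert r; induction a; intros r H; simpl; f_equal; auto.
  - apply IHa; intros [|n]; simpl; auto.
  - apply IHa; intros [|n]; simpl; auto.
Qed.

Lemma rename_inst r t a : rename r (inst t a) = inst (r t) (rename (up r) a).
Proof.
  unfold inst; rewrite !rename_comp; apply rename_ext; intros [|n]; reflexivity.
Qed.

Lemma rename_shift r a : rename (up r) (rename S a) = rename S (rename r a).
Proof. rewrite !rename_comp; reflexivity. Qed.

Lemma map_rename_shift r G :
  map (rename (up r)) (map (rename S) G) = map (rename S) (map (rename r) G).
Proof. rewrite !map_map; apply map_ext; intro; apply rename_shift. Qed.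

Lemma bounded_rename a : bounded a -> forall r, bounded (rename r a).
Proof. induction 1; intro r; simpl; constructor; auto. Qed.

(** All axioms other than separation are closed. Renaming the parameters of a separation instance
    gives the instance for the formula renamed below its two distinguished variables, and
    boundedness is kept. *)
Lemma BIZ_rename a r : BIZ a -> BIZ (rename r a).
Proof.
  destruct 1 as [| | | | |a B]; try (constructor; fail).
  replace (rename r (Separation a)) with (Separation (rename (up (up r)) a)).
  - constructor; now apply bounded_rename.
  - unfold Separation; simpl; rewrite !rename_comp.
    rewrite (rename_ext a (fun n => up S (up (up r) n))
                          (fun n => up (up (up r)) (up S n))); trivial.
    intros [|[|n]]; reflexivity.
Qed.

Lemma prv_rename G a : prv BIZ G a ->
  forall r, prv BIZ (map (rename r) G) (rename r a).
Proof.
  induction 1; intro r; simpl in *.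
  - apply prv_ax; now apply BIZ_rename.
  - apply prv_hyp; now apply in_map.
  - apply prv_botE; auto.
  - apply prv_andI; auto.
  - eapply prv_andE1; auto.
  - eapply prv_andE2; auto.
  - apply prv_orI1; auto.
  - apply prv_orI2; auto.
  - eapply prv_orE; eauto.
  - apply prv_impI; auto.
  - eapply prv_impE; eauto.
  - apply prv_allI; rewrite <- map_rename_shift; auto.
  - rewrite rename_inst; apply prv_allE; auto.
  - apply prv_exI with (t := r t); rewrite <- rename_inst; auto.
  - eapply prv_exE; [apply IHprv1|].
    rewrite <- map_rename_shift, <- rename_shift; apply IHprv2.
  - apply prv_eqI.
  - rewrite rename_inst; eapply prv_eqE; [apply IHprv1|].
    rewrite <- rename_inst; apply IHprv2.
Qed.

Lemma prv_weaken T G a : prv T G a -> forall D, incl G D -> prv T D a.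
Proof.
  induction 1; intros D I; try (econstructor; eauto; fail).
  - eapply prv_orE; [apply IHprv1; auto|apply IHprv2|apply IHprv3];
      apply incl_cons; simpl; auto; now apply incl_tl.
  - apply prv_impI, IHprv, incl_cons; simpl; auto; now apply incl_tl.
  - apply prv_allI, IHprv; now apply incl_map.
  - eapply prv_exE; [apply IHprv1; auto|apply IHprv2].
    apply incl_cons; simpl; auto; now apply incl_tl, incl_map.
Qed.

(** Only finitely many indices occur in a formula; any index beyond the bound [N] is fresh for
    it. *)
Lemma fin_support a : exists N, forall r r',
  (forall n, n < N -> r n = r' n) -> rename r a = rename r' a.
Proof.
  induction a as [i j|i j| |a [N HN] b [M HM]|a [N HN] b [M HM]
                 |a [N HN] b [M HM]|a [N HN]|a [N HN]].
  1,2: exists (S (i + j)); intros r r' H; simpl; f_equal; apply H; lia.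
  1: exists 0; reflexivity.
  1-3: exists (N + M); intros r r' H; simpl; f_equal;
    [apply HN|apply HM]; intros n L; apply H; lia.
  1-2: exists N; intros r r' H; simpl; f_equal; apply HN, up_ext, H.
Qed.

Lemma fin_support_list G : exists N, forall r r',
  (forall n, n < N -> r n = r' n) -> map (rename r) G = map (rename r') G.
Proof.
  induction G as [|a G [N HN]].
  - exists 0; reflexivity.
  - destruct (fin_support a) as [M HM].
    exists (N + M); intros r r' H; simpl; f_equal;
      [apply HM|apply HN]; intros n L; apply H; lia.
Qed.

(** Take [t] beyond all indices of [G], [a] and [c], and let [r] send [t] to 0 and shift everything
    else. Then [r] turns a derivation about the named variable [t] into one about the innermost de
    Bruijn variable. *)
Lemma fresh_renaming G a c : exists t r,
  map (rename r) G = map (rename S) G /\ rename r (inst t a) = a /\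
  rename r c = rename S c.
Proof.
  destruct (fin_support_list (c :: G)) as [N HN].
  destruct (fin_support a) as [M HM].
  set (r := fun n => if n =? N + M then 0 else S n).
  assert (Hr : forall n, n < N + M -> r n = S n).
  { intros n L; unfold r; destruct (Nat.eqb_spec n (N + M)); lia. }
  exists (N + M), r.
  assert (E : map (rename r) (c :: G) = map (rename S) (c :: G)).
  { apply HN; intros n L; apply Hr; lia. }
  injection E as E1 E2; repeat split; trivial.
  unfold inst; rewrite rename_comp, <- (rename_id a (fun n => n)) at 1 by trivial.
  rewrite rename_comp.
  transitivity (rename (fun n => n) a); [|now apply rename_id].
  apply HM; intros [|n] L.
  - unfold r; now rewrite Nat.eqb_refl.
  - apply Hr; lia.
Qed.

(** The premise is used at a single fresh [t] only. In this form a quantifier of the object language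
    is introduced by quantifying over Rocq variables. *)
Lemma prv_allI_fresh G a : (forall t, prv BIZ G (inst t a)) -> prv BIZ G (All a).
Proof.
  intro H; destruct (fresh_renaming G a Bot) as (t & r & E1 & E2 & _).
  apply prv_allI; rewrite <- E1, <- E2; now apply prv_rename.
Qed.

Lemma prv_exE_fresh G a c : prv BIZ G (Ex a) ->
  (forall t, prv BIZ (inst t a :: G) c) -> prv BIZ G c.
Proof.
  intros H K; destruct (fresh_renaming G a c) as (t & r & E1 & E2 & E3).
  apply prv_exE with a; trivial.
  rewrite <- E1, <- E3; rewrite <- E2 at 1; exact (prv_rename _ _ (K t) r).
Qed.

(** * Forcing *)

(* The last field says that truth can be checked on a cover, a cover of [G]
   being a family of extensions of [G] such that what is derivable in all of
   them is derivable in [G].  It is what makes disjunctions and existentials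
   eliminable into every truth value. *)
Record tv := TV {
  tholds : list form -> Prop;
  tholds_mono : forall G D, incl G D -> tholds G -> tholds D;
  tholds_local : forall G,
    (forall D c, incl G D ->
       (forall D', incl D D' -> tholds D' -> prv BIZ D' c) -> prv BIZ D c) ->
    tholds G }.

Definition forces (G : list form) (P : tv) : Prop := tholds P G.

Declare Scope tv_scope.
Delimit Scope tv_scope with tv.
Bind Scope tv_scope with tv.
Open Scope tv_scope.

Notation "G ⊩ P" := (forces G P%tv) (at level 98, no associativity).

Lemma mono G D P : incl G D -> G ⊩ P -> D ⊩ P.
Proof. apply tholds_mono. Qed.
Arguments mono {G D P} _ _.

Program Definition atom (a : form) : tv := TV (fun G => prv BIZ G a) _ _.
Next Obligation. eapply prv_weaken; eauto. Qed.
Next Obligation. apply H; auto using incl_refl. Qed.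

Program Definition tand (P Q : tv) : tv := TV (fun G => (G ⊩ P) /\ (G ⊩ Q)) _ _.
Next Obligation. split; eapply mono; eauto. Qed.
Next Obligation.
  split; apply tholds_local; intros D c I K; apply H; trivial;
    intros D' I' [? ?]; apply K; trivial.
Qed.

Program Definition timp (P Q : tv) : tv :=
  TV (fun G => forall D, incl G D -> D ⊩ P -> D ⊩ Q) _ _.
Next Obligation. apply H0; trivial. eapply incl_tran; eauto. Qed.
Next Obligation.
  apply tholds_local; intros D1 c I1 K; apply H.
  - eapply incl_tran; eauto.
  - intros D2 I2 HPQ; apply K; trivial; apply HPQ; [apply incl_refl|].
    eapply mono; [|exact H1]. eapply incl_tran; eauto.
Qed.

Program Definition tall (F : var -> tv) : tv := TV (fun G => forall x, G ⊩ F x) _ _.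
Next Obligation. eapply mono; eauto. Qed.
Next Obligation.
  apply tholds_local; intros D c I K; apply H; trivial.
  intros D' I' HF; exact (K D' I' (HF x)).
Qed.

(** The impredicative encoding of disjunction, with conclusions restricted to derivability of a
    formula [c]. By [tholds_local], elimination into an arbitrary truth value follows. The
    existential quantifier below is treated in the same way. *)
Program Definition tor (P Q : tv) : tv :=
  TV (fun G => forall D c, incl G D ->
        (forall D', incl D D' -> D' ⊩ P -> prv BIZ D' c) ->
        (forall D', incl D D' -> D' ⊩ Q -> prv BIZ D' c) -> prv BIZ D c) _ _.
Next Obligation. apply H0; trivial. eapply incl_tran; eauto. Qed.
Next Obligation.
  apply H; trivial. intros D' I' HO.
  apply HO; [apply incl_refl| |]; intros; [apply H1|apply H2]; trivial;
    eapply incl_tran; eauto.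
Qed.

Program Definition tex (F : var -> tv) : tv :=
  TV (fun G => forall D c, incl G D ->
        (forall D' x, incl D D' -> D' ⊩ F x -> prv BIZ D' c) -> prv BIZ D c) _ _.
Next Obligation. apply H0; trivial. eapply incl_tran; eauto. Qed.
Next Obligation.
  apply H; trivial. intros D' I' HO.
  apply HO; [apply incl_refl|]; intros; eapply H1; eauto. eapply incl_tran; eauto.
Qed.

Lemma mp {G P Q} : G ⊩ timp P Q -> G ⊩ P -> G ⊩ Q.
Proof. intros H HP; exact (H G (incl_refl _) HP). Qed.

Lemma orI1 {G P Q} : G ⊩ P -> G ⊩ tor P Q.
Proof. intros H D c I K _; apply K; [apply incl_refl|]. eapply mono; eauto. Qed.

Lemma orI2 {G P Q} : G ⊩ Q -> G ⊩ tor P Q.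
Proof. intros H D c I _ K; apply K; [apply incl_refl|]. eapply mono; eauto. Qed.

Lemma orE {G P Q R} : G ⊩ tor P Q -> (forall D, incl G D -> D ⊩ P -> D ⊩ R) ->
  (forall D, incl G D -> D ⊩ Q -> D ⊩ R) -> G ⊩ R.
Proof.
  intros H K1 K2; apply tholds_local; intros D c I K.
  apply H; trivial; intros D' I' HP; apply K; trivial; [apply K1|apply K2];
    trivial; eapply incl_tran; eauto.
Qed.

Lemma exI {G} {F : var -> tv} x : G ⊩ F x -> G ⊩ tex F.
Proof. intros H D c I K; apply (K D x); [apply incl_refl|]. eapply mono; eauto. Qed.

Lemma exE {G} {F : var -> tv} {R} : G ⊩ tex F ->
  (forall D, incl G D -> forall x, D ⊩ F x -> D ⊩ R) -> G ⊩ R.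
Proof.
  intros H K1; apply tholds_local; intros D c I K.
  apply H; trivial; intros D' x I' HP; apply K; trivial; eapply K1; eauto.
  eapply incl_tran; eauto.
Qed.

Lemma botE {G R} : G ⊩ atom Bot -> G ⊩ R.
Proof.
  intro H; apply tholds_local; intros D c I _; apply prv_botE.
  exact (mono I H).
Qed.

(** * Interpretation of formulas *)

Definition tmem (x y : var) : tv := atom (Mem x y).
Definition teq (x y : var) : tv := atom (Eq x y).
Definition tbot : tv := atom Bot.
Definition tiff (P Q : tv) : tv := tand (timp P Q) (timp Q P).
Definition tneg (P : tv) : tv := timp P tbot.

Fixpoint sem (l : list var) (a : form) : tv :=
  match a with
  | Mem i j => tmem (nth i l 0) (nth j l 0)
  | Eq i j => teq (nth i l 0) (nth j l 0)
  | Bot => tbot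
  | And a b => tand (sem l a) (sem l b)
  | Or a b => tor (sem l a) (sem l b)
  | Imp a b => timp (sem l a) (sem l b)
  | All a => tall (fun x => sem (x :: l) a)
  | Ex a => tex (fun x => sem (x :: l) a)
  end.

Definition env (l : list var) (n : nat) : nat := nth n l 0.

Lemma inst_env l x a : inst x (rename (up (env l)) a) = rename (env (x :: l)) a.
Proof. unfold inst; rewrite rename_comp; apply rename_ext; intros [|n]; reflexivity. Qed.

(** The truth lemma. From forcing to derivability, [Or] and [Ex] are eliminated into the very
    formula to be derived, implication is tested at the context extended by its premise, and [All]
    at a fresh variable. Conversely, the premises of the elimination rules are used at the context
    extended by the disjunct or the instance itself. *)
Lemma reflect a : forall l G, (G ⊩ sem l a) <-> prv BIZ G (rename (env l) a).
Proof.
  induction a as [i j|i j| |a IHa b IHb|a IHa b IHb|a IHa b IHb|a IHa|a IHa];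
    intros l G; simpl.
  1-3: reflexivity.
  - split.
    + intros [H1 H2]; apply prv_andI; [apply IHa|apply IHb]; trivial.
    + intro H; split; [apply IHa; eapply prv_andE1|apply IHb; eapply prv_andE2]; eauto.
  - split.
    + intro H; apply H; [apply incl_refl| |]; intros D I HP;
        [apply prv_orI1, IHa|apply prv_orI2, IHb]; trivial.
    + intros H D c I K1 K2. eapply prv_orE; [eapply prv_weaken; eauto| |].
      * apply K1; [apply incl_tl, incl_refl|]; apply IHa, prv_hyp; simpl; auto.
      * apply K2; [apply incl_tl, incl_refl|]; apply IHb, prv_hyp; simpl; auto.
  - split.
    + intro H; apply prv_impI, IHb, H; [apply incl_tl, incl_refl|].
      apply IHa, prv_hyp; simpl; auto.
    + intros H D I HP; apply IHb; eapply prv_impE; [eapply prv_weaken; eauto|].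
      now apply IHa.
  - split.
    + intro H; apply prv_allI_fresh; intro t; rewrite inst_env; apply IHa, H.
    + intros H x; apply IHa; rewrite <- inst_env; now apply prv_allE.
  - split.
    + intro H; apply H; [apply incl_refl|]; intros D x I HP.
      apply prv_exI with x; rewrite inst_env; now apply IHa.
    + intros H D c I K; eapply prv_exE_fresh; [eapply prv_weaken; eauto|].
      intro t; apply (K _ t); [apply incl_tl, incl_refl|].
      apply IHa; rewrite <- inst_env; apply prv_hyp; simpl; auto.
Qed.

(** Closedness is expressed as invariance under all renamings; it cancels [env []], which sends
    every index to the default variable 0. *)
Lemma provable_of_forces a : (forall G, G ⊩ sem [] (sentence a)) ->
  (forall r, rename r (sentence a) = sentence a) -> provable a.
Proof. intros H E; unfold provable; rewrite <- (E (env [])); apply reflect, H. Qed.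

Lemma forces_axiom a l G : BIZ a -> G ⊩ sem l a.
Proof. intro H; apply reflect, prv_ax; now apply BIZ_rename. Qed.

(** * Equality *)

Definition eqv (G : list form) (x y : var) : Prop := G ⊩ teq x y.

(** Agreement is required at all extensions of [G], since implication and disjunction look at them;
    this makes every connective compatible with [equiv]. *)
Definition equiv (G : list form) (P Q : tv) : Prop :=
  forall D, incl G D -> (D ⊩ P) <-> (D ⊩ Q).

Lemma eq_subst {G x y} a l : G ⊩ teq x y -> G ⊩ sem (x :: l) a -> G ⊩ sem (y :: l) a.
Proof.
  intros E H; apply reflect; rewrite <- inst_env; apply prv_eqE with x; trivial.
  rewrite inst_env; now apply reflect.
Qed.

#[global] Instance eqv_equiv G : Equivalence (eqv G).
Proof.
  assert (S : Symmetric (eqv G)).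
  { intros x y H; exact (eq_subst (Eq 0 1) [x] H (prv_eqI _ _ _)). }
  split; trivial.
  - intro x; apply prv_eqI.
  - intros x y z H1 H2; exact (eq_subst (Eq 0 1) [z] (S _ _ H1) H2).
Qed.

#[global] Instance equiv_equiv G : Equivalence (equiv G).
Proof.
  split; [intros P D I; reflexivity|intros P Q H D I; symmetry; auto|].
  intros P Q R H1 H2 D I; rewrite (H1 D I); auto.
Qed.

#[global] Instance forces_proper G : Proper (equiv G ==> Logic.iff) (forces G).
Proof. intros P Q H; apply H, incl_refl. Qed.

#[global] Instance tand_proper G : Proper (equiv G ==> equiv G ==> equiv G) tand.
Proof.
  intros P P' HP Q Q' HQ D I; specialize (HP D I); specialize (HQ D I).
  change ((D ⊩ P) /\ (D ⊩ Q) <-> (D ⊩ P') /\ (D ⊩ Q')); tauto.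
Qed.

#[global] Instance timp_proper G : Proper (equiv G ==> equiv G ==> equiv G) timp.
Proof.
  intros P P' HP Q Q' HQ D I; split; intros H D' I' K;
    apply (HQ D' (incl_tran I I')), H, (HP D' (incl_tran I I')), K; trivial.
Qed.

#[global] Instance tor_proper G : Proper (equiv G ==> equiv G ==> equiv G) tor.
Proof.
  intros P P' HP Q Q' HQ D I; split; intro H; apply (orE H); intros D' I' K;
    solve [apply orI1, (HP D' (incl_tran I I')), K
          |apply orI2, (HQ D' (incl_tran I I')), K].
Qed.

#[global] Instance tall_proper G :
  Proper (pointwise_relation var (equiv G) ==> equiv G) tall.
Proof. intros F F' H D I; split; intros K x; apply (H x D I), K. Qed.

#[global] Instance tex_proper G :
  Proper (pointwise_relation var (equiv G) ==> equiv G) tex.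
Proof.
  intros F F' H D I; split; intro K; apply (exE K); intros D' I' x Hx;
    apply exI with x, (H x D' (incl_tran I I')), Hx.
Qed.

#[global] Instance tmem_proper G : Proper (eqv G ==> eqv G ==> equiv G) tmem.
Proof.
  assert (H : forall D x x' y y', eqv D x x' -> eqv D y y' ->
            D ⊩ tmem x y -> D ⊩ tmem x' y').
  { intros D x x' y y' Hx Hy H.
    exact (eq_subst (Mem 1 0) [x'] Hy (eq_subst (Mem 0 1) [y] Hx H)). }
  intros x x' Hx y y' Hy D I; apply (mono I) in Hx; apply (mono I) in Hy.
  split; apply H; trivial; now symmetry.
Qed.

#[global] Instance teq_proper G : Proper (eqv G ==> eqv G ==> equiv G) teq.
Proof.
  intros x x' Hx y y' Hy D I; apply (mono I) in Hx; apply (mono I) in Hy.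
  change (eqv D x x') in Hx; change (eqv D y y') in Hy.
  change (eqv D x y <-> eqv D x' y'); now rewrite Hx, Hy.
Qed.

(** By induction on the formula, everything definable respects forced equality. The rewriting
    instances for the defined notions are obtained from this by exhibiting their formulas. *)
Lemma sem_congr G a : forall l l', Forall2 (eqv G) l l' -> equiv G (sem l a) (sem l' a).
Proof.
  assert (N : forall l l' i, Forall2 (eqv G) l l' -> eqv G (nth i l 0) (nth i l' 0)).
  { intros l l' i H; revert i; induction H; intros [|i]; simpl; trivial; reflexivity. }
  induction a; intros l l' H; simpl.
  - apply tmem_proper; auto.
  - apply teq_proper; auto.
  - reflexivity.
  - apply tand_proper; auto.
  - apply tor_proper; auto.
  - apply timp_proper; auto.
  - apply tall_proper; intro x; apply IHa; constructor; trivial; reflexivity.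
  - apply tex_proper; intro x; apply IHa; constructor; trivial; reflexivity.
Qed.

(** * Set theory inside the forcing relation *)

Notation "x ∈ y" := (tmem x y) : tv_scope.
Notation "x ≐ y" := (teq x y) : tv_scope.
Notation "¬ a" := (tneg a) : tv_scope.
Notation "a ∧ b" := (tand a b) : tv_scope.
Notation "a ∨ b" := (tor a b) : tv_scope.
Notation "a ⇒ b" := (timp a b) : tv_scope.
Notation "a ⇔ b" := (tiff a b) : tv_scope.
Notation "∀ x .. y , a" := (tall (fun x => .. (tall (fun y => a)) ..)) : tv_scope.
Notation "∃ x .. y , a" := (tex (fun x => .. (tex (fun y => a)) ..)) : tv_scope.

(* Each definition from here to [excludedMiddle] copies a formula of Defs, so that
   [sem] maps the formula to its copy by mere computation. *)
Definition tallin (A : var) (F : var -> tv) : tv := ∀ x, x ∈ A ⇒ F x.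
Definition texin (A : var) (F : var -> tv) : tv := ∃ x, x ∈ A ∧ F x.

Notation "∀' x ∈ A , a" := (tallin A (fun x => a)) : tv_scope.
Notation "∃' x ∈ A , a" := (texin A (fun x => a)) : tv_scope.

Definition sub (x y : var) : tv := ∀ z, z ∈ x ⇒ z ∈ y.
Definition isEmpty (x : var) : tv := ∀ z, ¬ z ∈ x.
Definition isOne (o : var) : tv := ∀ z, z ∈ o ⇔ isEmpty z.
Definition isTwo (t : var) : tv := ∀ z, z ∈ t ⇔ isEmpty z ∨ isOne z.
Definition isSucc (y x : var) : tv := ∀ z, z ∈ y ⇔ z ∈ x ∨ z ≐ x.
Definition isInductive (w : var) : tv :=
  (∃' e ∈ w, isEmpty e) ∧ (∀' x ∈ w, ∃' y ∈ w, isSucc y x).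
Definition isNat (w : var) : tv := isInductive w ∧ (∀ v, isInductive v ⇒ sub w v).
Definition isUPair (z x y : var) : tv := ∀ u, u ∈ z ⇔ u ≐ x ∨ u ≐ y.
Definition isPair (z x y : var) : tv :=
  ∃ a b, isUPair a x x ∧ isUPair b x y ∧ isUPair z a b.
Definition rel (r x y : var) : tv := ∃' z ∈ r, isPair z x y.
Definition isProd (P A B : var) : tv :=
  ∀ z, z ∈ P ⇔ (∃' a ∈ A, ∃' b ∈ B, isPair z a b).
Definition isSum (S A B : var) : tv :=
  ∀ z, z ∈ S ⇔
    (∃' a ∈ A, ∃ i, isEmpty i ∧ isPair z i a) ∨
    (∃' b ∈ B, ∃ i, isOne i ∧ isPair z i b).
Definition isFun (f A B : var) : tv :=
  (∀' z ∈ f, ∃' x ∈ A, ∃' y ∈ B, isPair z x y) ∧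
  (∀' x ∈ A, ∃ y, rel f x y ∧ (∀ y', rel f x y' ⇒ y' ≐ y)).
Definition isInj (f A B : var) : tv :=
  isFun f A B ∧ (∀ x x' y, rel f x y ⇒ rel f x' y ⇒ x ≐ x').
Definition isBij (f A B : var) : tv :=
  isInj f A B ∧ (∀' y ∈ B, ∃' x ∈ A, rel f x y).
Definition isPreimage (A f X B : var) : tv :=
  ∀ x, x ∈ A ⇔ x ∈ X ∧ (∃' y ∈ B, rel f x y).
Definition isRestriction (k h A : var) : tv :=
  ∀ z, z ∈ k ⇔ z ∈ h ∧ (∃' x ∈ A, ∃ y, isPair z x y).
Definition myhill (X : var) : tv :=
  ∀ A B, sub A X ⇒ sub B X ⇒
  ∀ f g, isInj f X X ⇒ isInj g X X ⇒
    isPreimage A f X B ⇒ isPreimage B g X A ⇒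
    ∃ h, isBij h X X ∧ (∃ k, isRestriction k h A ∧ isBij k A B).
Definition comp (g f u v : var) : tv := ∃ m, rel f u m ∧ rel g m v.
Definition iterate (w X g f n x y : var) : tv :=
  ∃ s, isFun s w X ∧
    (∃ e, isEmpty e ∧ rel s e x) ∧
    (∀' i ∈ w, ∀' j ∈ w, isSucc j i ⇒
       ∀ u v, rel s i u ⇒ rel s j v ⇒ comp g f u v) ∧
    rel s n y.
Definition rNonneg (w X f g n x y : var) : tv :=
  ∃ z, iterate w X g f n x z ∧ rel f z y.
Definition rNeg (w X f g n x y : var) : tv :=
  ∃ z, iterate w X f g n y z ∧ rel g z x.
Definition rUnion (w X f g x y : var) : tv :=
  ∃' n ∈ w, rNonneg w X f g n x y ∨ rNeg w X f g n x y.
Definition strongMyhill (X : var) : tv :=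
  ∀ w, isNat w ⇒
  ∀ f g, isInj f X X ⇒ isInj g X X ⇒
    ∃ h, isBij h X X ∧ (∀ x y, rel h x y ⇒ rUnion w X f g x y).
Definition lpo : tv :=
  ∀ w t, isNat w ⇒ isTwo t ⇒
  ∀ p, isFun p w t ⇒
    (∀' n ∈ w, ∃ e, isEmpty e ∧ rel p n e) ∨
    (∃' n ∈ w, ∃ o, isOne o ∧ rel p n o).
Definition inhabited (p : var) : tv := ∃' e ∈ p, isEmpty e.
Definition excludedMiddle : tv :=
  ∀ o, isOne o ⇒ ∀ p, sub p o ⇒ inhabited p ∨ ¬ inhabited p.
Definition myhillClosure : tv :=
  ∀ A B, strongMyhill A ⇒ strongMyhill B ⇒
    (∃ S, isSum S A B ∧ myhill S) ∨ (∃ P, isProd P A B ∧ myhill P).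

(** * Rules and tactics for forced statements *)

Notation "f · a" := (mp f a) (at level 11, left associativity).

Lemma iff1 {G P Q} : G ⊩ P ⇔ Q -> G ⊩ P -> G ⊩ Q.
Proof. intros [H _] K; exact (H · K). Qed.

Lemma iff2 {G P Q} : G ⊩ P ⇔ Q -> G ⊩ Q -> G ⊩ P.
Proof. intros [_ H] K; exact (H · K). Qed.

Lemma iffI {G P Q} : (forall D, incl G D -> D ⊩ P -> D ⊩ Q) ->
  (forall D, incl G D -> D ⊩ Q -> D ⊩ P) -> G ⊩ P ⇔ Q.
Proof. intros H K; split; assumption. Qed.

Lemma impI {G P Q} : (forall D, incl G D -> D ⊩ P -> D ⊩ Q) -> G ⊩ P ⇒ Q.
Proof. trivial. Qed.

Lemma allI {G} {F : var -> tv} : (forall x, G ⊩ F x) -> G ⊩ tall F.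
Proof. trivial. Qed.

Lemma teq_refl {G} x : G ⊩ x ≐ x.
Proof. apply (reflexivity (R := eqv G)). Qed.

Lemma teq_sym {G x y} : G ⊩ x ≐ y -> G ⊩ y ≐ x.
Proof. apply (symmetry (R := eqv G)). Qed.

Lemma teq_trans {G x y z} : G ⊩ x ≐ y -> G ⊩ y ≐ z -> G ⊩ x ≐ z.
Proof. apply (transitivity (R := eqv G)). Qed.

(** On passing to an extension, all forced hypotheses are transported by monotonicity and the old
    context is dropped when possible, so that a proof reads as if it took place in one world. *)
Ltac lift I :=
  match type of I with incl ?G ?D =>
    repeat match goal with
      | H : forces G _ |- _ => apply (mono I) in H
      | H : eqv G _ _ |- _ => apply (mono I) in H
      end;
    clear I; try clear G
  end.

Ltac hintro H :=
  cbv beta;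
  lazymatch goal with
  | |- forces _ (tall _) => refine (allI _); intro H
  | |- forces _ (timp _ _) =>
      refine (impI _); let D := fresh "G" in let I := fresh "I" in
      intros D I H; lift I
  | |- forces ?G ?P => let P' := eval red in P in change (forces G P'); hintro H
  end; cbv beta.

Tactic Notation "hi" ident(a) := hintro a.
Tactic Notation "hi" ident(a) ident(b) := hintro a; hintro b.
Tactic Notation "hi" ident(a) ident(b) ident(c) := hi a b; hintro c.
Tactic Notation "hi" ident(a) ident(b) ident(c) ident(d) := hi a b c; hintro d.
Tactic Notation "hi" ident(a) ident(b) ident(c) ident(d) ident(e) :=
  hi a b c d; hintro e.
Tactic Notation "hi" ident(a) ident(b) ident(c) ident(d) ident(e) ident(f) :=
  hi a b c d e; hintro f.

Tactic Notation "hi" ident(a) ident(b) ident(c) ident(d) ident(e) ident(f) ident(g) :=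
  hi a b c d e f; hintro g.
Tactic Notation "hi" ident(a) ident(b) ident(c) ident(d) ident(e) ident(f) ident(g) ident(h) :=
  hi a b c d e f g; hintro h.

Tactic Notation "have" constr(P) "as" simple_intropattern(p) :=
  match goal with |- forces ?G _ => assert (forces G P) as p end.
Tactic Notation "have" constr(P) "as" simple_intropattern(p) "by" tactic(t) :=
  match goal with |- forces ?G _ => assert (forces G P) as p by t end.

Tactic Notation "obtain" ident(x) simple_intropattern(p) "from" uconstr(H) :=
  refine (exE H _);
  let D := fresh "G" in let I := fresh "I" in let K := fresh "K" in
  intros D I x K; lift I; cbv beta in K; revert K; intros p.

Tactic Notation "cases" uconstr(H) "as" simple_intropattern(p) "|" simple_intropattern(q) :=
  refine (orE H _ _);
  [ let D := fresh "G" in let I := fresh "I" in let K := fresh "K" in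
    intros D I K; lift I; cbv beta in K; revert K; intros p
  | let D := fresh "G" in let I := fresh "I" in let K := fresh "K" in
    intros D I K; lift I; cbv beta in K; revert K; intros q ].

Ltac hiff H :=
  cbv beta;
  refine (iffI _ _);
  let D := fresh "G" in let I := fresh "I" in intros D I H; lift I; cbv beta in *.

Ltac absurd_by H := refine (botE H).

Ltac rw H :=
  let E := fresh in
  pose proof (H : eqv _ _ _) as E; rewrite E; clear E.
Ltac rwi H K :=
  let E := fresh in
  pose proof (H : eqv _ _ _) as E; rewrite E in K; clear E.
Ltac rwli H K :=
  let E := fresh in
  pose proof (H : eqv _ _ _) as E; rewrite <- E in K; clear E.

(** * Rewriting along forced equality *)

#[global] Instance tneg_proper G : Proper (equiv G ==> equiv G) tneg.
Proof. intros P P' H; now apply timp_proper. Qed.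

Ltac forall2 := repeat first [assumption | apply Forall2_cons | apply Forall2_nil].

#[global] Instance isEmpty_proper G : Proper (eqv G ==> equiv G) isEmpty.
Proof. intros x x' Hx; refine (sem_congr _ (IsEmpty 0 1) [x] [x'] _); forall2. Qed.
#[global] Instance isOne_proper G : Proper (eqv G ==> equiv G) isOne.
Proof. intros x x' Hx; refine (sem_congr _ (IsOne 0 1) [x] [x'] _); forall2. Qed.
#[global] Instance isSucc_proper G : Proper (eqv G ==> eqv G ==> equiv G) isSucc.
Proof. intros x x' Hx y y' Hy; refine (sem_congr _ (IsSucc 0 1 2) [y; x] [y'; x'] _); forall2. Qed.
#[global] Instance isUPair_proper G :
  Proper (eqv G ==> eqv G ==> eqv G ==> equiv G) isUPair.
Proof.
  intros x x' Hx y y' Hy z z' Hz.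
  refine (sem_congr _ (IsUPair 0 1 2 3) [z; y; x] [z'; y'; x'] _); forall2.
Qed.
#[global] Instance isPair_proper G :
  Proper (eqv G ==> eqv G ==> eqv G ==> equiv G) isPair.
Proof.
  intros x x' Hx y y' Hy z z' Hz.
  refine (sem_congr _ (IsPair 0 1 2 3) [z; y; x] [z'; y'; x'] _); forall2.
Qed.
#[global] Instance rel_proper G :
  Proper (eqv G ==> eqv G ==> eqv G ==> equiv G) rel.
Proof.
  intros x x' Hx y y' Hy z z' Hz.
  refine (sem_congr _ (Rel 0 1 2 3) [z; y; x] [z'; y'; x'] _); forall2.
Qed.

(** * Bounded separation *)

(** What an application of separation needs: a bounded formula [a] whose meaning in the environment
    [l] is [P]. In applications [a] starts as an existential variable and is built from [P] by the
    lemmas below. *)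
Definition denotes (a : form) (l : list var) (P : tv) : Prop :=
  bounded a /\ forall G, (G ⊩ sem l a) <-> (G ⊩ P).

Lemma nth_head (x : var) l : nth 0 (x :: l) 0 = x.
Proof. reflexivity. Qed.

Lemma nth_tail i (x y : var) l : nth i l 0 = x -> nth (S i) (y :: l) 0 = x.
Proof. trivial. Qed.

Lemma denotes_mem i j l x y : nth i l 0 = x -> nth j l 0 = y ->
  denotes (Mem i j) l (x ∈ y).
Proof. intros <- <-; split; [constructor|reflexivity]. Qed.

Lemma denotes_eq i j l x y : nth i l 0 = x -> nth j l 0 = y ->
  denotes (Eq i j) l (x ≐ y).
Proof. intros <- <-; split; [constructor|reflexivity]. Qed.

Lemma denotes_bot l : denotes Bot l tbot.
Proof. split; [constructor|reflexivity]. Qed.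

Lemma equiv_of G P Q : (forall D, (D ⊩ P) <-> (D ⊩ Q)) -> equiv G P Q.
Proof. intros H D _; apply H. Qed.

Lemma denotes_and a b l P Q : denotes a l P -> denotes b l Q ->
  denotes (And a b) l (P ∧ Q).
Proof.
  intros [Ba Ha] [Bb Hb]; split; [now constructor|intro G].
  apply (tand_proper G); [apply equiv_of, Ha|apply equiv_of, Hb|apply incl_refl].
Qed.

Lemma denotes_or a b l P Q : denotes a l P -> denotes b l Q ->
  denotes (Or a b) l (P ∨ Q).
Proof.
  intros [Ba Ha] [Bb Hb]; split; [now constructor|intro G].
  apply (tor_proper G); [apply equiv_of, Ha|apply equiv_of, Hb|apply incl_refl].
Qed.

Lemma denotes_imp a b l P Q : denotes a l P -> denotes b l Q ->
  denotes (Imp a b) l (P ⇒ Q).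
Proof.
  intros [Ba Ha] [Bb Hb]; split; [now constructor|intro G].
  apply (timp_proper G); [apply equiv_of, Ha|apply equiv_of, Hb|apply incl_refl].
Qed.

Lemma denotes_all a l j c F : (forall x, denotes a (x :: l) (F x)) ->
  nth j l 0 = c -> denotes (All (Imp (Mem 0 (S j)) a)) l (tallin c F).
Proof.
  intros H <-; split; [constructor; apply (H 0)|intro G].
  apply (tall_proper G); [|apply incl_refl]; intro x.
  apply timp_proper; [reflexivity|apply equiv_of, (H x)].
Qed.

Lemma denotes_ex a l j c F : (forall x, denotes a (x :: l) (F x)) ->
  nth j l 0 = c -> denotes (Ex (And (Mem 0 (S j)) a)) l (texin c F).
Proof.
  intros H <-; split; [constructor; apply (H 0)|intro G].
  apply (tex_proper G); [|apply incl_refl]; intro x.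
  apply tand_proper; [reflexivity|apply equiv_of, (H x)].
Qed.

Lemma denotes_iff a l P Q : (forall G, (G ⊩ P) <-> (G ⊩ Q)) ->
  denotes a l Q -> denotes a l P.
Proof. intros H [B K]; split; trivial; intro G; now rewrite H. Qed.

(* All variables in the context are taken as parameters of a separation axiom. *)
Ltac context_vars l :=
  match goal with
  | x : var |- _ => lazymatch l with context [x] => fail | _ => context_vars (x :: l) end
  | _ => l
  end.
Ltac lookup := first [apply nth_head | apply nth_tail; lookup].
(** A hook, redefined once bounded equivalents of the pairing, one and successor predicates are
    available. *)
Ltac denote_defined := fail.
Ltac denote :=
  cbv beta;
  first [ denote_defined |
  lazymatch goal with
  | |- denotes _ _ (tmem _ _) => apply denotes_mem; lookup
  | |- denotes _ _ (teq _ _) => apply denotes_eq; lookup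
  | |- denotes _ _ tbot => apply denotes_bot
  | |- denotes _ _ (tand _ _) => eapply denotes_and; denote
  | |- denotes _ _ (tor _ _) => eapply denotes_or; denote
  | |- denotes _ _ (timp _ _) => eapply denotes_imp; denote
  | |- denotes _ _ (tall _) => eapply denotes_all; [intro; denote|lookup]
  | |- denotes _ _ (tex _) => eapply denotes_ex; [intro; denote|lookup]
  | |- denotes ?a ?l ?P => let Q := eval red in P in change (denotes a l Q); denote
  end ].

Lemma separation {G} a l x (P : var -> tv) :
  (forall z, denotes a (z :: x :: l) (P z)) ->
  G ⊩ ∃ y, ∀ z, z ∈ y ⇔ z ∈ x ∧ P z.
Proof.
  intro H; assert (B : bounded a) by apply (H 0).
  obtain y Hy from (forces_axiom _ l G (BIZ_separation a B) x).
  (* The axiom places the new set [y] between [z] and [x] in the environment; [rename (up S)] makes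
     the formula skip it. *)
  assert (E : forall D z,
            (D ⊩ sem (z :: y :: x :: l) (rename (up S) a)) <-> (D ⊩ P z)).
  { intros D z; destruct (H z) as [_ Hz]; rewrite <- Hz, !reflect, rename_comp.
    replace (rename (fun n => env (z :: y :: x :: l) (up S n)) a)
      with (rename (env (z :: x :: l)) a); [reflexivity|].
    apply rename_ext; intros [|n]; reflexivity. }
  apply exI with y; hi z; destruct (Hy z) as [H1 H2]; split; intros D I K;
    apply (mono I) in H1; apply (mono I) in H2.
  - destruct (H1 · K) as [K1 K2]; split; [exact K1|apply E, K2].
  - destruct K as [K1 K2]; refine (H2 · _); split; [exact K1|apply E, K2].
Qed.

Tactic Notation "separate" constr(x) constr(P) "as" ident(y) ident(H) :=
  let l := context_vars (@nil var) in
  refine (exE (separation _ l x P _) _);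
  [ intro; denote
  | let D := fresh "G" in let I := fresh "I" in intros D I y H; lift I; cbv beta in H ].

Lemma ext {G x y} : G ⊩ (∀ z, z ∈ x ⇔ z ∈ y) -> G ⊩ x ≐ y.
Proof. intro H; exact (forces_axiom _ [] G BIZ_extensionality x y · H). Qed.

Lemma pairing {G} x y : G ⊩ ∃ z, isUPair z x y.
Proof. exact (forces_axiom _ [] G BIZ_pairing x y). Qed.

Lemma union {G} x : G ⊩ ∃ u, ∀ z, z ∈ u ⇔ (∃' y ∈ x, z ∈ y).
Proof. exact (forces_axiom _ [] G BIZ_union x). Qed.

Lemma powerset {G} x : G ⊩ ∃ p, ∀ z, z ∈ p ⇔ sub z x.
Proof. exact (forces_axiom _ [] G BIZ_powerset x). Qed.

Lemma infinity {G} : G ⊩ ∃ w, isInductive w.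
Proof. exact (forces_axiom _ [] G BIZ_infinity). Qed.

Lemma empty_exists {G} : G ⊩ ∃ e, isEmpty e.
Proof.
  obtain w [H _] from infinity. obtain e [_ He] from H. now apply exI with e.
Qed.

Ltac splits :=
  lazymatch goal with
  | |- forces _ (tand _ _) => split; [|splits]
  | _ => idtac
  end.

(** * Pairs and functions *)

Lemma isEmpty_unique {G x y} : G ⊩ isEmpty x -> G ⊩ isEmpty y -> G ⊩ x ≐ y.
Proof.
  intros Hx Hy; apply ext; hi z; hiff K.
  - absurd_by (Hx z · K).
  - absurd_by (Hy z · K).
Qed.

Lemma isUPair_left {G z x y} : G ⊩ isUPair z x y -> G ⊩ x ∈ z.
Proof. intro H; apply (iff2 (H x)), orI1, teq_refl. Qed.

Lemma isUPair_right {G z x y} : G ⊩ isUPair z x y -> G ⊩ y ∈ z.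
Proof. intro H; apply (iff2 (H y)), orI2, teq_refl. Qed.

Lemma isSingleton_eq {G z x u} : G ⊩ isUPair z x x -> G ⊩ u ∈ z -> G ⊩ u ≐ x.
Proof. intros H K; cases (iff1 (H u) K) as E | E; exact E. Qed.

Lemma isUPair_unique {G z z' x y} :
  G ⊩ isUPair z x y -> G ⊩ isUPair z' x y -> G ⊩ z ≐ z'.
Proof.
  intros H H'; apply ext; hi u; hiff K.
  - exact (iff2 (H' u) (iff1 (H u) K)).
  - exact (iff2 (H u) (iff1 (H' u) K)).
Qed.

Lemma pair_exists {G} x y : G ⊩ ∃ z, isPair z x y.
Proof.
  obtain a Ha from (pairing x x); obtain b Hb from (pairing x y).
  obtain z Hz from (pairing a b).
  apply exI with z, exI with a, exI with b; splits; assumption.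
Qed.

Lemma isPair_unique {G z z' x y} :
  G ⊩ isPair z x y -> G ⊩ isPair z' x y -> G ⊩ z ≐ z'.
Proof.
  intros H H'.
  obtain a K from H; obtain b (Ha & Hb & Hz) from K.
  obtain a' K' from H'; obtain b' (Ha' & Hb' & Hz') from K'.
  have (a ≐ a') as Ea by exact (isUPair_unique Ha Ha').
  have (b ≐ b') as Eb by exact (isUPair_unique Hb Hb').
  rwli Ea Hz'; rwli Eb Hz'; exact (isUPair_unique Hz Hz').
Qed.

Lemma isPair_inj {G z x y x' y'} :
  G ⊩ isPair z x y -> G ⊩ isPair z x' y' -> G ⊩ x ≐ x' ∧ y ≐ y'.
Proof.
  intros H H'.
  obtain a K from H; obtain b (Ha & Hb & Hz) from K.
  obtain a' K' from H'; obtain b' (Ha' & Hb' & Hz') from K'.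
  have (x ≐ x') as Ex.
  { cases (iff1 (Hz' a) (isUPair_left Hz)) as E | E; apply teq_sym;
      apply (isSingleton_eq Ha).
    - rw E; exact (isUPair_left Ha').
    - rw E; exact (isUPair_left Hb'). }
  split; [exact Ex|].
  rwli Ex Ha'; rwli Ex Hb'.
  have (a ≐ a') as Ea by exact (isUPair_unique Ha Ha').
  cases (iff1 (Hz' b) (isUPair_right Hz)) as E | E.
  - rwi E Hb; have (y ≐ x) as Ey by exact (isSingleton_eq Ha' (isUPair_right Hb)).
    cases (iff1 (Hz b') (isUPair_right Hz')) as E' | E'.
    + rwi E' Hb'; rw Ey; apply teq_sym; exact (isSingleton_eq Ha (isUPair_right Hb')).
    + rwi E' Hb'; rwi E Hb'; rw Ey; apply teq_sym.
      exact (isSingleton_eq Ha' (isUPair_right Hb')).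
  - rwi E Hb; cases (iff1 (Hb' y) (isUPair_right Hb)) as E1 | E1; [|exact E1].
    cases (iff1 (Hb y') (isUPair_right Hb')) as E2 | E2.
    + exact (teq_trans E1 (teq_sym E2)).
    + exact (teq_sym E2).
Qed.

(* Kuratowski pairs are defined with unbounded quantifiers, so [denotes] needs
   equivalent bounded formulas. *)
Lemma denotes_isUPair a l z x y :
  denotes a l (x ∈ z ∧ y ∈ z ∧ (∀' u ∈ z, u ≐ x ∨ u ≐ y)) -> denotes a l (isUPair z x y).
Proof.
  apply denotes_iff; intro G; split.
  - intro H; splits; [exact (isUPair_left H)|exact (isUPair_right H)|].
    hi u K; exact (iff1 (H u) K).
  - intros (Hx & Hy & H); hi u; hiff K.
    + exact (H u · K).
    + cases K as E | E; rw E; assumption.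
Qed.

Lemma denotes_isPair c l z x y :
  denotes c l (∃' a ∈ z, ∃' b ∈ z, isUPair a x x ∧ isUPair b x y ∧ isUPair z a b) ->
  denotes c l (isPair z x y).
Proof.
  apply denotes_iff; intro G; split; intro H.
  - obtain a K from H; obtain b (Ha & Hb & Hz) from K.
    apply exI with a; split; [exact (isUPair_left Hz)|].
    apply exI with b; split; [exact (isUPair_right Hz)|].
    splits; assumption.
  - obtain a [_ K] from H; obtain b [_ K'] from K.
    apply exI with a, exI with b; assumption.
Qed.

Lemma denotes_isOne a l o :
  denotes a l ((∃' z ∈ o, isEmpty z) ∧ (∀' z ∈ o, isEmpty z)) -> denotes a l (isOne o).
Proof.
  apply denotes_iff; intro G; split.
  - intro H; split.
    + obtain e He from empty_exists.
      apply exI with e; split; trivial; exact (iff2 (H e) He).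
    + hi z K; exact (iff1 (H z) K).
  - intros [H H']; hi z; hiff K.
    + exact (H' z · K).
    + obtain e [He He'] from H; rw (isEmpty_unique K He'); exact He.
Qed.

Lemma denotes_isSucc a l y x :
  denotes a l ((∀' z ∈ y, z ∈ x ∨ z ≐ x) ∧ (∀' z ∈ x, z ∈ y) ∧ x ∈ y) ->
  denotes a l (isSucc y x).
Proof.
  apply denotes_iff; intro G; split.
  - intro H; splits.
    + hi z K; exact (iff1 (H z) K).
    + hi z K; apply (iff2 (H z)), orI1, K.
    + apply (iff2 (H x)), orI2, teq_refl.
  - intros (H1 & H2 & H3); hi z; hiff K.
    + exact (H1 z · K).
    + cases K as K' | E; [exact (H2 z · K')|rw E; exact H3].
Qed.

Ltac denote_defined ::=
  lazymatch goal with
  | |- denotes _ _ (isUPair _ _ _) => apply denotes_isUPair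
  | |- denotes _ _ (isPair _ _ _) => apply denotes_isPair
  | |- denotes _ _ (isOne _) => apply denotes_isOne
  | |- denotes _ _ (isSucc _ _) => apply denotes_isSucc
  end; denote.

Lemma binary_union {G} a b : G ⊩ ∃ u, ∀ z, z ∈ u ⇔ z ∈ a ∨ z ∈ b.
Proof.
  obtain p Hp from (pairing a b); obtain u Hu from (union p).
  apply exI with u; hi z; hiff K.
  - obtain y [H K'] from (iff1 (Hu z) K).
    cases (iff1 (Hp y) H) as E | E; rwi E K'; [apply orI1|apply orI2]; exact K'.
  - apply (iff2 (Hu z)); cases K as K' | K'; [apply exI with a|apply exI with b];
      split; trivial; [exact (isUPair_left Hp)|exact (isUPair_right Hp)].
Qed.

(** Kuratowski pairs of elements of A ∪ B belong to its double power set, from which the product is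
    separated. *)
Lemma product_exists {G} A B : G ⊩ ∃ P, isProd P A B.
Proof.
  obtain u Hu from (binary_union A B).
  obtain p Hp from (powerset u); obtain q Hq from (powerset p).
  separate q (fun z => ∃' x ∈ A, ∃' y ∈ B, isPair z x y) as P HP.
  apply exI with P; hi z; hiff K.
  - exact (proj2 (iff1 (HP z) K)).
  - apply (iff2 (HP z)); split; [|exact K].
    obtain x [Hx K1] from K; obtain y [Hy K2] from K1.
    obtain a K3 from K2; obtain b (Ha & Hb & Hz) from K3.
    apply (iff2 (Hq z)); hi c Hc; apply (iff2 (Hp c)); hi v Hv; apply (iff2 (Hu v)).
    cases (iff1 (Hz c) Hc) as E | E; rwi E Hv.
    + apply orI1; rw (isSingleton_eq Ha Hv); exact Hx.
    + cases (iff1 (Hb v) Hv) as E' | E'; rw E'; [apply orI1|apply orI2]; assumption.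
Qed.

Definition isRelation (f A B : var) : tv := ∀' z ∈ f, ∃' x ∈ A, ∃' y ∈ B, isPair z x y.

Lemma Forall2_eqv_refl G l : Forall2 (eqv G) l l.
Proof. induction l; constructor; trivial; reflexivity. Qed.

(** A truth value depending on variables through a Rocq function need not respect forced equality;
    it does when a single formula denotes it. *)
Lemma denotes_congr {G a l l' P P'} : denotes a l P -> denotes a l' P' ->
  Forall2 (eqv G) l l' -> G ⊩ P -> G ⊩ P'.
Proof.
  intros [_ H] [_ H'] E K; apply H', (sem_congr G a l l' E G (incl_refl _)), H, K.
Qed.

(** Comprehension for binary relations, by separation from the product. The variables [z] and [p] in
    the hypothesis stand for the pair and the product that are present in the environment there. *)
Lemma relation_exists {G} a l A B (P : var -> var -> tv) :
  (forall y x z p, denotes a (y :: x :: z :: p :: A :: B :: l) (P x y)) ->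
  G ⊩ ∃ f, isRelation f A B ∧ ∀ x y, rel f x y ⇔ x ∈ A ∧ y ∈ B ∧ P x y.
Proof.
  intro H; obtain p Hp from (product_exists A B).
  refine (exE (separation _ (A :: B :: l) p
    (fun z => ∃' x ∈ A, ∃' y ∈ B, isPair z x y ∧ P x y) _) _).
  { intro z; eapply denotes_ex; [intro x|lookup]; eapply denotes_ex; [intro y|lookup].
    eapply denotes_and; [denote|apply H]. }
  intros D I f Hf; lift I; apply exI with f; split.
  - hi z Hz; obtain x [Hx K] from (proj2 (iff1 (Hf z) Hz)).
    obtain y (Hy & K' & _) from K.
    apply exI with x; split; trivial; apply exI with y; split; trivial.
  - hi x y; hiff K.
    + obtain z [Hz K'] from K; obtain x' [Hx K1] from (proj2 (iff1 (Hf z) Hz)).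
      obtain y' (Hy & K2 & K3) from K1; destruct (isPair_inj K2 K') as [Ex Ey].
      rwi Ex Hx; rwi Ey Hy; splits; trivial.
      apply (denotes_congr (H y' x' z z) (H y x z z)); trivial.
      constructor; [exact Ey|constructor; [exact Ex|apply Forall2_eqv_refl]].
    + destruct K as (Hx & Hy & HP); obtain z Hz from (pair_exists x y).
      apply exI with z; split; trivial; apply (iff2 (Hf z)); split.
      * apply (iff2 (Hp z)), exI with x; split; trivial; apply exI with y; split; trivial.
      * apply exI with x; split; trivial; apply exI with y; splits; trivial.
Qed.

Tactic Notation "relate" constr(A) constr(B) constr(P) "as" ident(f) simple_intropattern(p) :=
  let l := context_vars (@nil var) in
  refine (exE (relation_exists _ l A B P _) _);
  [ intros; denote
  | let D := fresh "G" in let I := fresh "I" in let K := fresh "K" in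
    intros D I f K; lift I; cbv beta in K; revert K; intros p ].

Lemma isFun_dom {G f A B x y} : G ⊩ isFun f A B -> G ⊩ rel f x y -> G ⊩ x ∈ A ∧ y ∈ B.
Proof.
  intros [H _] K; obtain z [Hz K'] from K.
  obtain x' [Hx K1] from (H z · Hz); obtain y' [Hy K2] from K1.
  destruct (isPair_inj K' K2) as [Ex Ey]; rw Ex; rw Ey; split; trivial.
Qed.

Lemma isFun_unique {G f A B x y y'} : G ⊩ isFun f A B ->
  G ⊩ rel f x y -> G ⊩ rel f x y' -> G ⊩ y ≐ y'.
Proof.
  intros Hf K K'; destruct (isFun_dom Hf K) as [Hx _]; destruct Hf as [_ H].
  obtain u [_ Hu] from (H x · Hx).
  exact (teq_trans (Hu y · K) (teq_sym (Hu y' · K'))).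
Qed.

Lemma isFun_total {G f A B x} : G ⊩ isFun f A B -> G ⊩ x ∈ A ->
  G ⊩ ∃ y, y ∈ B ∧ rel f x y.
Proof.
  intros Hf Hx; obtain y [K _] from (proj2 Hf x · Hx).
  apply exI with y; split; [apply (isFun_dom Hf K)|exact K].
Qed.

Lemma isFunI {G f A B} : G ⊩ isRelation f A B ->
  G ⊩ (∀ x, x ∈ A ⇒ ∃ y, rel f x y) ->
  G ⊩ (∀ x y y', rel f x y ⇒ rel f x y' ⇒ y ≐ y') -> G ⊩ isFun f A B.
Proof.
  intros H T U; split; [exact H|hi x Hx].
  obtain y K from (T x · Hx); apply exI with y; split; trivial.
  hi y' K'; exact (U x y' y · K' · K).
Qed.
(** * Natural numbers *)

Lemma succ_of {G} x : G ⊩ ∃ y, isSucc y x.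
Proof.
  obtain s Hs from (pairing x x); obtain u Hu from (binary_union x s).
  apply exI with u; hi z; hiff K.
  - cases (iff1 (Hu z) K) as K' | K'; [apply orI1, K'|apply orI2].
    exact (isSingleton_eq Hs K').
  - apply (iff2 (Hu z)); cases K as K' | E; [apply orI1, K'|apply orI2].
    rw E; exact (isUPair_left Hs).
Qed.

Lemma isSucc_self {G y x} : G ⊩ isSucc y x -> G ⊩ x ∈ y.
Proof. intro H; apply (iff2 (H x)), orI2, teq_refl. Qed.

Lemma isSucc_unique {G y y' x} : G ⊩ isSucc y x -> G ⊩ isSucc y' x -> G ⊩ y ≐ y'.
Proof.
  intros H H'; apply ext; hi z; hiff K.
  - exact (iff2 (H' z) (iff1 (H z) K)).
  - exact (iff2 (H z) (iff1 (H' z) K)).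
Qed.

Lemma isSucc_not_empty {G y x} : G ⊩ isSucc y x -> G ⊩ isEmpty y -> G ⊩ tbot.
Proof. intros H K; exact (K x · isSucc_self H). Qed.

Lemma zero_in_nat {G w e} : G ⊩ isNat w -> G ⊩ isEmpty e -> G ⊩ e ∈ w.
Proof.
  intros [[H _] _] He; obtain e' [He' K] from H.
  rw (isEmpty_unique He K); exact He'.
Qed.

Lemma succ_in_nat {G w n m} : G ⊩ isNat w -> G ⊩ n ∈ w -> G ⊩ isSucc m n -> G ⊩ m ∈ w.
Proof.
  intros [[_ H] _] Hn Hm; obtain m' [Hm' K] from (H n · Hn).
  rw (isSucc_unique Hm K); exact Hm'.
Qed.

(** Leastness of [w] concerns sets only, so [P] has to be denoted by a bounded formula: the
    separated subset {n ∈ w | P n} is inductive and hence contains [w]. *)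
Lemma nat_induction {G} a l w (P : var -> tv) :
  (forall z, denotes a (z :: w :: l) (P z)) -> G ⊩ isNat w ->
  G ⊩ (∀ e, isEmpty e ⇒ P e) -> G ⊩ (∀ n m, n ∈ w ⇒ P n ⇒ isSucc m n ⇒ P m) ->
  G ⊩ ∀ n, n ∈ w ⇒ P n.
Proof.
  intros D Hw H0 HS; refine (exE (separation _ l w P D) _); intros G1 I v Hv; lift I.
  have (sub w v) as H.
  { refine (proj2 Hw v · _); split.
    - obtain e [He K] from (proj1 (proj1 Hw)); apply exI with e; split; trivial.
      apply (iff2 (Hv e)); split; trivial; exact (H0 e · K).
    - hi n Hn; destruct (iff1 (Hv n) Hn) as [Hn1 Hn2].
      obtain m [Hm K] from (proj2 (proj1 Hw) n · Hn1); apply exI with m; split; trivial.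
      apply (iff2 (Hv m)); split; trivial; exact (HS n m · Hn1 · Hn2 · K). }
  hi n Hn; exact (proj2 (iff1 (Hv n) (H n · Hn))).
Qed.

Tactic Notation "induct" constr(Hw) constr(P) :=
  match type of Hw with forces ?G (isNat ?w) =>
  let l := context_vars (@nil var) in
  assert (forces G (∀ n, n ∈ w ⇒ P n)%tv);
  [ refine (nat_induction _ l w P _ Hw _ _); [intro; denote|cbv beta|cbv beta] | ]
  end.

Lemma nat_transitive {G w} : G ⊩ isNat w ->
  G ⊩ ∀ n, n ∈ w ⇒ ∀' y ∈ n, ∀' z ∈ y, z ∈ n.
Proof.
  intro Hw; induct Hw (fun n => ∀' y ∈ n, ∀' z ∈ y, z ∈ n); [| |assumption].
  - hi e He y Hy; absurd_by (He y · Hy).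
  - hi n m Hn IH Hm y Hy; hi z Hz; apply (iff2 (Hm z)), orI1.
    cases (iff1 (Hm y) Hy) as K | E; [exact ((IH y · K) z · Hz)|rwi E Hz; exact Hz].
Qed.

(** In the absence of foundation this needs induction: if m = n ∪ {n} belongs to itself, then m ∈ n
    or m = n, and either way n ∈ n. *)
Lemma nat_irreflexive {G w} : G ⊩ isNat w -> G ⊩ ∀ n, n ∈ w ⇒ ¬ n ∈ n.
Proof.
  intro Hw; induct Hw (fun n => ¬ n ∈ n); [| |assumption].
  - hi e He K; exact (He e · K).
  - hi n m Hn IH Hm K; refine (IH · _).
    cases (iff1 (Hm m) K) as K' | E.
    + exact (((nat_transitive Hw n · Hn) m · K') n · isSucc_self Hm).
    + rwi E K; exact K.
Qed.

(** Unless they are equal, [n] and [n'] are elements of each other, against transitivity and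
    irreflexivity. *)
Lemma succ_inj {G w n n' m} : G ⊩ isNat w -> G ⊩ n ∈ w -> G ⊩ n' ∈ w ->
  G ⊩ isSucc m n -> G ⊩ isSucc m n' -> G ⊩ n ≐ n'.
Proof.
  intros Hw Hn Hn' H H'.
  cases (iff1 (H' n) (isSucc_self H)) as K | E; [|exact E].
  cases (iff1 (H n') (isSucc_self H')) as K' | E; [|exact (teq_sym E)].
  absurd_by (nat_irreflexive Hw n · Hn · (((nat_transitive Hw n · Hn) n' · K') n · K)).
Qed.

Lemma zero_or_succ {G w} : G ⊩ isNat w ->
  G ⊩ ∀ n, n ∈ w ⇒ isEmpty n ∨ (∃' k ∈ w, isSucc n k).
Proof.
  intro Hw; induct Hw (fun n => isEmpty n ∨ (∃' k ∈ w, isSucc n k)); [| |assumption].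
  - hi e He; apply orI1, He.
  - hi n m Hn IH Hm; apply orI2, exI with n; split; trivial.
Qed.

Lemma nat_eq_dec {G w} : G ⊩ isNat w ->
  G ⊩ ∀ n, n ∈ w ⇒ ∀' m ∈ w, n ≐ m ∨ ¬ n ≐ m.
Proof.
  intro Hw; induct Hw (fun n => ∀' m ∈ w, n ≐ m ∨ ¬ n ≐ m); [| |assumption].
  - hi e He m Hm; cases (zero_or_succ Hw m · Hm) as K | K.
    + apply orI1; exact (isEmpty_unique He K).
    + apply orI2; hi E; obtain k [_ Hk] from K; rwi E He; exact (isSucc_not_empty Hk He).
  - hi n n' Hn IH Hn' m Hm; cases (zero_or_succ Hw m · Hm) as K | K.
    + apply orI2; hi E; rwli E K; exact (isSucc_not_empty Hn' K).
    + obtain k [Hk Hkm] from K; cases (IH k · Hk) as E | E.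
      * apply orI1; rwi E Hn'; exact (isSucc_unique Hn' Hkm).
      * apply orI2; hi E'; rwli E' Hkm; exact (E · succ_inj Hw Hn Hk Hn' Hkm).
Qed.

Lemma nat_exists {G} : G ⊩ ∃ w, isNat w.
Proof.
  obtain v Hv from infinity; obtain p Hp from (powerset v).
  (* The intersection of all inductive subsets of [v]; quantifying over the power set [p] keeps the
     definition bounded. *)
  separate v (fun n => ∀' u ∈ p, (∃' e ∈ u, isEmpty e) ⇒
    (∀' x ∈ u, ∃' y ∈ u, isSucc y x) ⇒ n ∈ u) as w Hw.
  have (isInductive w) as Iw.
  { split.
    - obtain e [He K] from (proj1 Hv); apply exI with e; split; trivial.
      apply (iff2 (Hw e)); split; trivial; hi u Hu H1 H2.
      obtain e' [He' K'] from H1; rw (isEmpty_unique K K'); exact He'.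
    - hi n Hn; destruct (iff1 (Hw n) Hn) as [Hn1 Hn2].
      obtain m [Hm K] from (proj2 Hv n · Hn1); apply exI with m; split; trivial.
      apply (iff2 (Hw m)); split; trivial; hi u Hu H1 H2.
      obtain m' [Hm' K'] from (H2 n · (Hn2 u · Hu · H1 · H2)).
      rw (isSucc_unique K K'); exact Hm'. }
  apply exI with w; split; trivial; hi u Iu n Hn.
  (* An arbitrary inductive set [u] is cut down to u ∩ v, which is inductive and one of the sets
     being intersected. *)
  separate v (fun n => n ∈ u) as u' Hu'.
  refine (proj2 (iff1 (Hu' n) (proj2 (iff1 (Hw n) Hn) u' · iff2 (Hp u') _ · _ · _))).
  - hi z Hz; exact (proj1 (iff1 (Hu' z) Hz)).
  - obtain e [He K] from (proj1 Iu); obtain e' [He' K'] from (proj1 Hv).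
    apply exI with e; split; trivial; apply (iff2 (Hu' e)); split; trivial.
    rw (isEmpty_unique K K'); exact He'.
  - hi z Hz; destruct (iff1 (Hu' z) Hz) as [Hz1 Hz2].
    obtain m [Hm K] from (proj2 Iu z · Hz2); obtain m' [Hm' K'] from (proj2 Hv z · Hz1).
    apply exI with m; split; trivial; apply (iff2 (Hu' m)); split; trivial.
    rw (isSucc_unique K K'); exact Hm'.
Qed.

(** * Sequences defined by recursion *)

Definition isOrbit (w X c s a : var) : tv :=
  isFun s w X ∧ (∃ e, isEmpty e ∧ rel s e a) ∧
  (∀' i ∈ w, ∀' j ∈ w, isSucc j i ⇒ ∀ u v, rel s i u ⇒ rel s j v ⇒ rel c u v).

(** The recursion theorem. The sequence is the least relation that contains (0, a) and is closed
    under (i, u) ↦ (i + 1, c(u)). Totality is an induction; single-valuedness is an induction in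
    which minimality is applied to a suitably restricted closed relation. *)
Lemma orbit_exists {G w X c a} : G ⊩ isNat w -> G ⊩ isFun c X X -> G ⊩ a ∈ X ->
  G ⊩ ∃ s, isOrbit w X c s a.
Proof.
  intros Hw Hc Ha; obtain e He from empty_exists.
  obtain W HW from (product_exists w X); obtain pw Hpw from (powerset W).
  pose (closed := fun Z => (rel Z e a ∧
    ∀' i ∈ w, ∀' j ∈ w, ∀' u ∈ X, ∀' v ∈ X,
      isSucc j i ⇒ rel Z i u ⇒ rel c u v ⇒ rel Z j v)%tv).
  relate w X (fun n x => ∀' Z ∈ pw, rel Z e a ∧ (∀' i ∈ w, ∀' j ∈ w, ∀' u ∈ X, ∀' v ∈ X,
      isSucc j i ⇒ rel Z i u ⇒ rel c u v ⇒ rel Z j v) ⇒ rel Z n x) as s [Hs Es].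
  have (∀ Z n x, isRelation Z w X ⇒ closed Z ⇒ rel s n x ⇒ rel Z n x) as Hmin.
  { hi Z n x HZ C K; destruct (iff1 (Es n x) K) as (_ & _ & M).
    refine (M Z · iff2 (Hpw Z) _ · C); hi z Hz; exact (iff2 (HW z) (HZ z · Hz)). }
  have (rel s e a) as S0.
  { apply (iff2 (Es e a)); splits; [exact (zero_in_nat Hw He)|exact Ha|].
    hi Z HZ C; exact (proj1 C). }
  have (∀ i j u v, isSucc j i ⇒ rel s i u ⇒ rel c u v ⇒ rel s j v) as SS.
  { hi i j u v Hj K Hv; destruct (iff1 (Es i u) K) as (Hi & Hu & M).
    pose proof (succ_in_nat Hw Hi Hj) as Hj'.
    destruct (isFun_dom Hc Hv) as [_ Hv'].
    apply (iff2 (Es j v)); splits; trivial.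
    hi Z HZ C; exact ((((proj2 C i · Hi) j · Hj') u · Hu) v · Hv' · Hj · (M Z · HZ · C) · Hv). }
  have (∀ n, n ∈ w ⇒ ∃' x ∈ X, rel s n x) as T.
  { induct Hw (fun n => ∃' x ∈ X, rel s n x); [| |assumption].
    - hi e' He'; apply exI with a; split; trivial.
      rw (isEmpty_unique He' He); exact S0.
    - hi n m Hn IH Hm; obtain u [Hu K] from IH; obtain v [Hv K'] from (isFun_total Hc Hu).
      apply exI with v; split; trivial; exact (SS n m u v · Hm · K · K'). }
  have (∀ n, n ∈ w ⇒ ∀' x ∈ X, ∀' x' ∈ X, rel s n x ⇒ rel s n x' ⇒ x ≐ x') as U.
  { induct Hw (fun n => ∀' x ∈ X, ∀' x' ∈ X, rel s n x ⇒ rel s n x' ⇒ x ≐ x');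
      [| |assumption].
    - hi e' He'.
      (* [Z] restricts the value at 0 alone. A step always leads to a successor, so [Z] is
         closed. *)
      relate w X (fun n x => isEmpty n ⇒ x ≐ a) as Z [HZ EZ].
      have (closed Z) as C.
      { split.
        - apply (iff2 (EZ e a)); splits; trivial; [exact (zero_in_nat Hw He)|].
          hi _h; apply teq_refl.
        - hi i Hi j Hj u Hu v; hi Hv Hij K K'; apply (iff2 (EZ j v)); splits; trivial.
          hi Hj0; absurd_by (isSucc_not_empty Hij Hj0). }
      hi x Hx x' Hx' K K'.
      refine (teq_trans _ (teq_sym _)).
      + exact (proj2 (proj2 (iff1 (EZ e' x) (Hmin Z e' x · HZ · C · K))) · He').
      + exact (proj2 (proj2 (iff1 (EZ e' x') (Hmin Z e' x' · HZ · C · K'))) · He').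
    - hi n m Hn IH Hm; obtain u [Hu K] from (T n · Hn).
      obtain v [Hv Huv] from (isFun_total Hc Hu).
      (* From [s], only pairs at [m] with a value other than [v] = c(u) are left out. A step into
         [m] starts at [n], where the induction hypothesis makes [u] the only value, so [Z] is
         closed. *)
      relate w X (fun k x => rel s k x ∧ (k ≐ m ⇒ x ≐ v)) as Z [HZ EZ].
      have (closed Z) as C.
      { split.
        - apply (iff2 (EZ e a)); splits; trivial; [exact (zero_in_nat Hw He)|].
          hi E; rwi E He; absurd_by (isSucc_not_empty Hm He).
        - hi i Hi j Hj u' Hu' v'; hi Hv' Hij K1 K2.
          destruct (iff1 (EZ i u') K1) as (_ & _ & K3 & _).
          apply (iff2 (EZ j v')); splits; trivial; [exact (SS i j u' v' · Hij · K3 · K2)|].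
          hi E; rwi E Hij; pose proof (succ_inj Hw Hi Hn Hij Hm) as E'; rwi E' K3.
          pose proof ((IH u' · Hu') u · Hu · K3 · K) as E''; rwi E'' K2.
          exact (isFun_unique Hc K2 Huv). }
      hi x Hx x' Hx' K1 K2.
      refine (teq_trans _ (teq_sym _)).
      + exact (proj2 (proj2 (proj2 (iff1 (EZ m x) (Hmin Z m x · HZ · C · K1)))) · teq_refl m).
      + exact (proj2 (proj2 (proj2 (iff1 (EZ m x') (Hmin Z m x' · HZ · C · K2)))) · teq_refl m). }
  apply exI with s; unfold isOrbit; splits.
  - apply (isFunI Hs).
    + hi n Hn; obtain x [_ K] from (T n · Hn); now apply exI with x.
    + hi n x x' K K'; destruct (iff1 (Es n x) K) as (Hn & Hx & _).
      destruct (iff1 (Es n x') K') as (_ & Hx' & _).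
      exact (((U n · Hn) x · Hx) x' · Hx' · K · K').
  - apply exI with e; split; trivial.
  - hi i Hi j Hj Hij u v K; hi K'.
    destruct (iff1 (Es i u) K) as (_ & Hu & _); destruct (iff1 (Es j v) K') as (_ & Hv & _).
    obtain v' [Hv' K1] from (isFun_total Hc Hu).
    rw (((U j · Hj) v · Hv) v' · Hv' · K' · (SS i j u v' · Hij · K · K1)); exact K1.
Qed.

(** * Searching the natural numbers *)

Lemma isOneI {G o e} : G ⊩ isEmpty e -> G ⊩ isUPair o e e -> G ⊩ isOne o.
Proof.
  intros He Ho; hi z; hiff K.
  - rw (isSingleton_eq Ho K); exact He.
  - rw (isEmpty_unique K He); exact (isUPair_left Ho).
Qed.

Lemma one_exists {G} : G ⊩ ∃ o, isOne o.
Proof.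
  obtain e He from empty_exists; obtain o Ho from (pairing e e).
  apply exI with o; exact (isOneI He Ho).
Qed.

Lemma isOne_unique {G o o'} : G ⊩ isOne o -> G ⊩ isOne o' -> G ⊩ o ≐ o'.
Proof.
  intros H H'; apply ext; hi z; hiff K.
  - exact (iff2 (H' z) (iff1 (H z) K)).
  - exact (iff2 (H z) (iff1 (H' z) K)).
Qed.

Lemma isOne_not_empty {G o} : G ⊩ isOne o -> G ⊩ isEmpty o -> G ⊩ tbot.
Proof.
  intros H K; obtain e He from empty_exists; exact (K e · iff2 (H e) He).
Qed.

Lemma two_exists {G} : G ⊩ ∃ t, isTwo t.
Proof.
  obtain e He from empty_exists; obtain o Ho from one_exists.
  obtain t Ht from (pairing e o); apply exI with t; hi z; hiff K.
  - cases (iff1 (Ht z) K) as E | E; rw E; [apply orI1|apply orI2]; assumption.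
  - cases K as K' | K'.
    + rw (isEmpty_unique K' He); exact (isUPair_left Ht).
    + rw (isOne_unique K' Ho); exact (isUPair_right Ht).
Qed.

(** LPO for decidable bounded predicates: it is applied to the characteristic function [p] of T = {n
    ∈ w | P n}, which is total by decidability. *)
Lemma lpo_search {G} a l w (P : var -> tv) :
  (forall z, denotes a (z :: w :: l) (P z)) -> G ⊩ lpo -> G ⊩ isNat w ->
  G ⊩ (∀ n, n ∈ w ⇒ P n ∨ ¬ P n) ->
  G ⊩ (∃ n, n ∈ w ∧ P n) ∨ (∀ n, n ∈ w ⇒ ¬ P n).
Proof.
  intros D Hlpo Hw Hdec; refine (exE (separation _ l w P D) _).
  intros G1 I T HT; lift I; obtain t Ht from two_exists.
  relate w t (fun n v => (n ∈ T ∧ isOne v) ∨ (¬ n ∈ T ∧ isEmpty v)) as p [Hp Ep].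
  have (isFun p w t) as F.
  { apply (isFunI Hp).
    - hi n Hn; cases (Hdec n · Hn) as K | K.
      + obtain o Ho from one_exists; apply exI with o, (iff2 (Ep n o)); splits; trivial.
        * apply (iff2 (Ht o)), orI2, Ho.
        * apply orI1; split; trivial; apply (iff2 (HT n)); split; trivial.
      + obtain e He from empty_exists; apply exI with e, (iff2 (Ep n e)); splits; trivial.
        * apply (iff2 (Ht e)), orI1, He.
        * apply orI2; split; trivial; hi K'; exact (K · proj2 (iff1 (HT n) K')).
    - hi n x y K K'; cases (proj2 (proj2 (iff1 (Ep n x) K))) as [A B] | [A B];
        cases (proj2 (proj2 (iff1 (Ep n y) K'))) as [A' B'] | [A' B'].
      + exact (isOne_unique B B').
      + absurd_by (A' · A).
      + absurd_by (A · A').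
      + exact (isEmpty_unique B B'). }
  cases ((Hlpo w t · Hw · Ht) p · F) as K | K.
  - apply orI2; hi n Hn HP; obtain e [He K'] from (K n · Hn).
    cases (proj2 (proj2 (iff1 (Ep n e) K'))) as [A B] | [A B].
    + exact (isOne_not_empty B He).
    + refine (A · iff2 (HT n) _); split; trivial.
  - apply orI1; obtain n [Hn K1] from K; obtain o [Ho K'] from K1.
    apply exI with n; split; trivial.
    cases (proj2 (proj2 (iff1 (Ep n o) K'))) as [A B] | [A B].
    + exact (proj2 (iff1 (HT n) A)).
    + absurd_by (isOne_not_empty Ho B).
Qed.

Tactic Notation "search" constr(Hlpo) constr(Hw) constr(P) "as" ident(H) :=
  match type of Hw with forces ?G (isNat ?w) =>
  let l := context_vars (@nil var) in
  assert (forces G ((∃ n, n ∈ w ∧ P n) ∨ (∀ n, n ∈ w ⇒ ¬ P n))%tv) as H;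
  [ refine (lpo_search _ l w P _ Hlpo Hw _); [intro; denote|cbv beta] | cbv beta in H ]
  end.

(** * The Cantor-Bernstein construction on the natural numbers *)

Lemma isBijI {G h A B} : G ⊩ isFun h A B ->
  G ⊩ (∀ x x' y, rel h x y ⇒ rel h x' y ⇒ x ≐ x') ->
  G ⊩ (∀ y, y ∈ B ⇒ ∃ x, rel h x y) -> G ⊩ isBij h A B.
Proof.
  intros F I S; split; [split; trivial|hi y Hy].
  obtain x K from (S y · Hy); apply exI with x; split; trivial; exact (proj1 (isFun_dom F K)).
Qed.

Lemma rel_dec {G f A X x y} : G ⊩ isNat X -> G ⊩ isFun f A X -> G ⊩ x ∈ A -> G ⊩ y ∈ X ->
  G ⊩ rel f x y ∨ ¬ rel f x y.
Proof.
  intros HX Hf Hx Hy; obtain v [Hv K] from (isFun_total Hf Hx).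
  cases ((nat_eq_dec HX v · Hv) y · Hy) as E | E.
  - apply orI1; rwi E K; exact K.
  - apply orI2; hi K'; exact (E · isFun_unique Hf K K').
Qed.

Lemma composite_exists {G f g X} : G ⊩ isFun f X X -> G ⊩ isFun g X X ->
  G ⊩ ∃ c, isFun c X X ∧ ∀ u v, rel c u v ⇔ comp g f u v.
Proof.
  intros Hf Hg; relate X X (fun u v => ∃' m ∈ X, rel f u m ∧ rel g m v) as c [Hc Ec].
  apply exI with c; split; [apply (isFunI Hc)|].
  - hi u Hu; obtain m [Hm K] from (isFun_total Hf Hu).
    obtain v [Hv L] from (isFun_total Hg Hm); apply exI with v, (iff2 (Ec u v)).
    splits; trivial; apply exI with m; splits; trivial.
  - hi u v v' K K'; obtain m (_ & L1 & L2) from (proj2 (proj2 (iff1 (Ec u v) K))).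
    obtain m' (_ & L1' & L2') from (proj2 (proj2 (iff1 (Ec u v') K'))).
    rwi (isFun_unique Hf L1 L1') L2; exact (isFun_unique Hg L2 L2').
  - hi u v; hiff K.
    + obtain m (_ & L) from (proj2 (proj2 (iff1 (Ec u v) K))); apply exI with m, L.
    + obtain m [L1 L2] from K; apply (iff2 (Ec u v)).
      destruct (isFun_dom Hf L1) as [Hu Hm]; splits; trivial.
      * exact (proj2 (isFun_dom Hg L2)).
      * apply exI with m; splits; trivial.
Qed.

(** The bijections constructed below lie in the union of R_0 and R_{-1}, and both of these involve
    the zeroth iterate. *)
Lemma iterate_zero {G w X f g e x} : G ⊩ isNat w -> G ⊩ isFun f X X -> G ⊩ isFun g X X ->
  G ⊩ isEmpty e -> G ⊩ x ∈ X -> G ⊩ iterate w X g f e x x.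
Proof.
  intros Hw Hf Hg He Hx; obtain c [Hc Ec] from (composite_exists Hf Hg).
  obtain s (Hs & H0 & HS) from (orbit_exists Hw Hc Hx).
  apply exI with s; splits; trivial.
  - hi i Hi j Hj Hij u v; hi K K'.
    exact (iff1 (Ec u v) (((HS i · Hi) j · Hj · Hij) u v · K · K')).
  - obtain e' [He' K] from H0; rw (isEmpty_unique He He'); exact K.
Qed.

(* [x] is obtained from [b] by iterating [c]; [pX] is the power set of [X]. *)
Definition reaches (X pX c b x : var) : tv :=
  ∀' Z ∈ pX, b ∈ Z ⇒ (∀' u ∈ Z, ∀' v ∈ X, rel c u v ⇒ v ∈ Z) ⇒ x ∈ Z.

(** The points reached from [b] are the values of the orbit [s] of [b], and LPO searches [s] for
    [x]. The set [X] of natural numbers serves both as the carrier and as the index set of [s]. *)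
Lemma reaches_dec {G X pX c b x} : G ⊩ lpo -> G ⊩ isNat X ->
  G ⊩ (∀ z, z ∈ pX ⇔ sub z X) -> G ⊩ isFun c X X -> G ⊩ b ∈ X -> G ⊩ x ∈ X ->
  G ⊩ reaches X pX c b x ∨ ¬ reaches X pX c b x.
Proof.
  intros Hlpo HX HpX Hc Hb Hx; obtain s (Hs & H0 & HS) from (orbit_exists HX Hc Hb).
  search Hlpo HX (fun n => rel s n x) as H.
  { hi n Hn; exact (rel_dec HX Hs Hn Hx). }
  cases H as K | K.
  - apply orI1; obtain n [Hn L] from K; hi Z HZ HbZ HcZ.
    induct HX (fun n => ∀' y ∈ X, rel s n y ⇒ y ∈ Z).
    + hi e He y Hy M; obtain e' [He' M'] from H0.
      rwi (isEmpty_unique He He') M; rw (isFun_unique Hs M M'); exact HbZ.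
    + hi k m Hk IH Hm y Hy; hi M; obtain u [Hu N] from (isFun_total Hs Hk).
      exact ((HcZ u · ((IH u · Hu) · N)) y · Hy
        · (((HS k · Hk) m · succ_in_nat HX Hk Hm · Hm) u y · N · M)).
    + exact ((H1 n · Hn) x · Hx · L).
  - apply orI2; hi R.
    (* The range of the orbit contains [b] and is closed under [c], so a reached point must lie in
       it. *)
    separate X (fun y => ∃' n ∈ X, rel s n y) as Z HZ.
    have (x ∈ Z) as M; [refine (R Z · (iff2 (HpX Z) _) · _ · _)|].
    + hi z Hz; exact (proj1 (iff1 (HZ z) Hz)).
    + apply (iff2 (HZ b)); split; trivial; obtain e [He L] from H0.
      apply exI with e; split; trivial; exact (zero_in_nat HX He).
    + hi u Hu v Hv L; apply (iff2 (HZ v)); split; trivial.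
      obtain n [Hn M] from (proj2 (iff1 (HZ u) Hu)); obtain m Hm from (succ_of n).
      pose proof (succ_in_nat HX Hn Hm) as Hm'; apply exI with m; split; trivial.
      obtain v' [Hv' N] from (isFun_total Hs Hm').
      rw (isFun_unique Hc L (((HS n · Hn) m · Hm' · Hm) u v' · M · N)); exact N.
    + obtain n [Hn L] from (proj2 (iff1 (HZ x) M)); exact (K n · Hn · L).
Qed.

Lemma reaches_refl {G X pX c b} : G ⊩ reaches X pX c b b.
Proof. hi Z HZ HbZ HcZ; exact HbZ. Qed.

Lemma reaches_step {G X pX c b u v} : G ⊩ reaches X pX c b u -> G ⊩ isFun c X X ->
  G ⊩ rel c u v -> G ⊩ reaches X pX c b v.
Proof.
  intros R Hc K; hi Z HZ HbZ HcZ.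
  exact ((HcZ u · (R Z · HZ · HbZ · HcZ)) v · proj2 (isFun_dom Hc K) · K).
Qed.

#[global] Instance reaches_proper G X pX c :
  Proper (eqv G ==> eqv G ==> equiv G) (reaches X pX c).
Proof.
  assert (H : forall D b b' x x', eqv D b b' -> eqv D x x' ->
    D ⊩ reaches X pX c b x -> D ⊩ reaches X pX c b' x').
  { intros D b b' x x' Eb Ex R; hi Z HZ HbZ HcZ.
    rwi (teq_sym Eb) HbZ; rw (teq_sym Ex); exact (R Z · HZ · HbZ · HcZ). }
  intros b b' Eb x x' Ex D I; apply (mono I) in Eb; apply (mono I) in Ex.
  split; apply H; trivial; now apply teq_sym.
Qed.

(** The set consisting of [b] and the images under [c] of reached points contains [b] and is closed
    under [c]. *)
Lemma reaches_inv {G X pX c b x} : G ⊩ (∀ z, z ∈ pX ⇔ sub z X) -> G ⊩ isFun c X X ->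
  G ⊩ b ∈ X -> G ⊩ reaches X pX c b x ->
  G ⊩ x ≐ b ∨ (∃ u, reaches X pX c b u ∧ rel c u x).
Proof.
  intros HpX Hc Hb R.
  separate X (fun y => y ≐ b ∨ (∃' u ∈ X, reaches X pX c b u ∧ rel c u y)) as Z HZ.
  have (x ∈ Z) as M; [refine (R Z · (iff2 (HpX Z) _) · _ · _)|].
  - hi z Hz; exact (proj1 (iff1 (HZ z) Hz)).
  - apply (iff2 (HZ b)); split; trivial; apply orI1, teq_refl.
  - hi u Hu v Hv L; apply (iff2 (HZ v)); split; trivial; apply orI2.
    destruct (iff1 (HZ u) Hu) as [Hu' K]; apply exI with u; splits; trivial.
    cases K as E | K'; [rw E; exact reaches_refl|].
    obtain u' (_ & R' & N) from K'; exact (reaches_step R' Hc N).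
  - cases (proj2 (iff1 (HZ x) M)) as E | K; [apply orI1, E|apply orI2].
    obtain u [_ K'] from K; apply exI with u, K'.
Qed.

(** LPO decides the range of [f] and reachability under g ∘ f, hence membership in the set on which
    the Cantor-Bernstein construction switches from [f] to the inverse of [g]. *)
Lemma nat_strongMyhill {G X} : G ⊩ lpo -> G ⊩ isNat X -> G ⊩ strongMyhill X.
Proof.
  intros Hlpo HX; hi w Hw f g Hf Hg; destruct Hf as [Ff If], Hg as [Fg Ig].
  obtain c [Hc Ec] from (composite_exists Ff Fg); obtain pX HpX from (powerset X).
  (* [D] is the set of points whose backward chain stops outside the range of
     [f]; the bijection is the inverse of [g] on [D] and [f] elsewhere. *)
  separate X (fun x => ∃' y ∈ X, (∀' z ∈ X, ¬ rel f z y) ∧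
    (∃' b ∈ X, rel g y b ∧ reaches X pX c b x)) as D HD.
  have (∀ y, y ∈ X ⇒ (∃ x, x ∈ X ∧ rel f x y) ∨ (∀ x, x ∈ X ⇒ ¬ rel f x y)) as ran_dec.
  { hi y Hy; search Hlpo HX (fun x => rel f x y) as H; [|exact H].
    hi x Hx; exact (rel_dec HX Ff Hx Hy). }
  have (∀ x, x ∈ X ⇒ x ∈ D ∨ ¬ x ∈ D) as Ddec.
  { hi x Hx; search Hlpo HX (fun y => (∀' z ∈ X, ¬ rel f z y) ∧
      (∃' b ∈ X, rel g y b ∧ reaches X pX c b x)) as H.
    - hi y Hy; cases (ran_dec y · Hy) as K | K.
      + apply orI2; hi M; obtain z [Hz L] from K; exact (proj1 M z · Hz · L).
      + obtain b [Hb L] from (isFun_total Fg Hy).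
        cases (reaches_dec Hlpo HX HpX Hc Hb Hx) as R | R.
        * apply orI1; split; trivial; apply exI with b; splits; trivial.
        * apply orI2; hi M; obtain b' (Hb' & L' & R') from (proj2 M).
          rwi (isFun_unique Fg L' L) R'; exact (R · R').
    - cases H as K | K.
      + apply orI1, (iff2 (HD x)); split; trivial.
      + apply orI2; hi M; obtain y [Hy N] from (proj2 (iff1 (HD x) M)).
        exact (K y · Hy · N). }
  have (∀ y b, y ∈ X ⇒ rel g y b ⇒ (∀ x, x ∈ X ⇒ ¬ rel f x y) ⇒ b ∈ D) as Dbase.
  { hi y b Hy L K; destruct (isFun_dom Fg L) as [_ Hb].
    apply (iff2 (HD b)); split; trivial.
    apply exI with y; splits; trivial; apply exI with b; splits; trivial.
    exact reaches_refl. }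
  have (∀ u v, u ∈ D ⇒ rel c u v ⇒ v ∈ D) as Dstep.
  { hi u v Hu L; destruct (iff1 (HD u) Hu) as [_ K].
    obtain y (Hy & K1 & K2) from K; obtain b (Hb & K3 & R) from K2.
    apply (iff2 (HD v)); split; [exact (proj2 (isFun_dom Hc L))|].
    apply exI with y; splits; trivial; apply exI with b; splits; trivial.
    exact (reaches_step R Hc L). }
  have (∀ x, x ∈ D ⇒ (∃ y, (∀' z ∈ X, ¬ rel f z y) ∧ rel g y x) ∨
                     (∃ u, u ∈ D ∧ rel c u x)) as Dinv.
  { hi x Hx; destruct (iff1 (HD x) Hx) as [_ K].
    obtain y (Hy & K1 & K2) from K; obtain b (Hb & K3 & R) from K2.
    cases (reaches_inv HpX Hc Hb R) as E | K4.
    - apply orI1, exI with y; split; trivial; rw E; trivial.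
    - apply orI2; obtain u [R' L] from K4; apply exI with u; split; trivial.
      apply (iff2 (HD u)); split; [exact (proj1 (isFun_dom Hc L))|].
      apply exI with y; splits; trivial; apply exI with b; splits; trivial. }
  relate X X (fun x y => (x ∈ D ∧ rel g y x) ∨ (¬ x ∈ D ∧ rel f x y)) as h [Hh Eh].
  have (∀ x y, (x ∈ D ∧ rel g y x) ∨ (¬ x ∈ D ∧ rel f x y) ⇒ rel h x y) as hI.
  { hi x y K; apply (iff2 (Eh x y)); cases K as [A B] | [A B].
    - destruct (isFun_dom Fg B); splits; trivial; apply orI1; split; trivial.
    - destruct (isFun_dom Ff B); splits; trivial; apply orI2; split; trivial. }
  (* The two pieces of [h] have disjoint images. If x = g(y) starts its chain in [D], then [y] is
     outside the range of [f]. Otherwise x = g(f(u)) with u ∈ D, and f(x') = y = f(u) would put x'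
     in [D]. *)
  have (∀ x x' y, x ∈ D ⇒ rel g y x ⇒ ¬ x' ∈ D ⇒ ¬ rel f x' y) as hX.
  { hi x x' y Hx Lg Hx' Lf; cases (Dinv x · Hx) as K | K.
    - obtain z [K1 K2] from K; rwi (Ig y z x · Lg · K2) Lf.
      exact (K1 x' · proj1 (isFun_dom Ff Lf) · Lf).
    - obtain u [Hu L] from K; obtain m [L1 L2] from (iff1 (Ec u x) L).
      rwi (Ig m y x · L2 · Lg) L1; rwi (If u x' y · L1 · Lf) Hu; exact (Hx' · Hu). }
  apply exI with h; split.
  - apply isBijI; [apply (isFunI Hh)| |].
    + hi x Hx; cases (Ddec x · Hx) as K | K.
      * cases (Dinv x · K) as L | L.
        -- obtain y [_ L2] from L; apply exI with y; refine (hI x y · orI1 _).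
           split; trivial.
        -- obtain u [Hu L1] from L; obtain m [_ L2] from (iff1 (Ec u x) L1).
           apply exI with m; refine (hI x m · orI1 _); split; trivial.
      * obtain y [_ L] from (isFun_total Ff Hx).
        apply exI with y; refine (hI x y · orI2 _); split; trivial.
    + hi x y y' K K'; cases (proj2 (proj2 (iff1 (Eh x y) K))) as [A B] | [A B];
        cases (proj2 (proj2 (iff1 (Eh x y') K'))) as [A' B'] | [A' B'].
      * exact (Ig y y' x · B · B').
      * absurd_by (A' · A).
      * absurd_by (A · A').
      * exact (isFun_unique Ff B B').
    + hi x x' y K K'; cases (proj2 (proj2 (iff1 (Eh x y) K))) as [A B] | [A B];
        cases (proj2 (proj2 (iff1 (Eh x' y) K'))) as [A' B'] | [A' B'].
      * exact (isFun_unique Fg B B').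
      * absurd_by (hX x x' y · A · B · A' · B').
      * absurd_by (hX x' x y · A' · B' · A · B).
      * exact (If x x' y · B · B').
    (* The preimage of [y] is b = g(y) if that lies in [D]. If not, [y] is in the range of [f], and
       its preimage under [f] is outside [D] because [D] is closed under g ∘ f. *)
    + hi y Hy; obtain b [Hb L] from (isFun_total Fg Hy); cases (Ddec b · Hb) as K | K.
      * apply exI with b; refine (hI b y · orI1 _); split; trivial.
      * cases (ran_dec y · Hy) as M | M; [|absurd_by (K · (Dbase y b · Hy · L · M))].
        obtain x [Hx N] from M; apply exI with x; refine (hI x y · orI2 _).
        split; trivial; hi Dx; refine (K · (Dstep x b · Dx · iff2 (Ec x b) _)).
        apply exI with y; split; trivial.
  (* With n = 0, the pairs with x = g(y) are in R_{-1} and those with y = f(x) in R_0. *)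
  - hi x y K; destruct (iff1 (Eh x y) K) as (Hx & Hy & K').
    obtain e He from empty_exists; apply exI with e; split; [exact (zero_in_nat Hw He)|].
    cases K' as [_ L] | [_ L].
    + apply orI2, exI with y; split; trivial; exact (iterate_zero Hw Fg Ff He Hy).
    + apply orI1, exI with x; split; trivial; exact (iterate_zero Hw Ff Fg He Hx).
Qed.
(** * From the Myhill property to decidability *)

(** The bijection is [f] itself, which lies in R_0. For surjectivity, compare v = f(0) with the
    target [y]: if they differ, one of them is 1, so 1 is known to be in [B], and by injectivity
    f(1) is the element of 2 other than f(0), that is, [y]. *)
Lemma subtwo_strongMyhill {G t B p} : G ⊩ isTwo t ->
  G ⊩ (∀ z, z ∈ B ⇔ z ∈ t ∧ (isEmpty z ∨ inhabited p)) -> G ⊩ strongMyhill B.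
Proof.
  intros Ht HB; hi w Hw f g Hf Hg; destruct Hf as [Ff If], Hg as [Fg Ig].
  obtain e He from empty_exists.
  have (e ∈ B) as HeB.
  { apply (iff2 (HB e)); split; [apply (iff2 (Ht e))|]; apply orI1, He. }
  have (∀ y, y ∈ B ⇒ isEmpty y ∨ isOne y) as Bdec.
  { hi y Hy; exact (iff1 (Ht y) (proj1 (iff1 (HB y) Hy))). }
  obtain v [Hv L] from (isFun_total Ff HeB).
  apply exI with f; split.
  - apply isBijI; trivial; hi y Hy; cases (Bdec v · Hv) as V | V.
    + cases (Bdec y · Hy) as Y | Y.
      * apply exI with e; rw (isEmpty_unique Y V); exact L.
      * obtain u [Hu M] from (isFun_total Ff Hy); cases (Bdec u · Hu) as U | U.
        -- rwi (isEmpty_unique U V) M; pose proof (If e y v · L · M) as E; rwi E He.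
           absurd_by (isOne_not_empty Y He).
        -- apply exI with y; rwi (isOne_unique U Y) M; exact M.
    + cases (Bdec y · Hy) as Y | Y.
      * obtain u [Hu M] from (isFun_total Ff Hv); cases (Bdec u · Hu) as U | U.
        -- apply exI with v; rwi (isEmpty_unique U Y) M; exact M.
        -- rwi (isOne_unique U V) M; pose proof (If e v v · L · M) as E; rwi E He.
           absurd_by (isOne_not_empty V He).
      * apply exI with e; rw (isOne_unique Y V); exact L.
  - hi x y K; destruct (isFun_dom Ff K) as [Hx _].
    apply exI with e; split; [exact (zero_in_nat Hw He)|].
    apply orI1, exI with x; split; trivial; exact (iterate_zero Hw Ff Fg He Hx).
Qed.

(** The even numbers [E] are the indices at which the orbit of 0 under negation on 2 takes the value
    0. *)
Lemma parity_exists {G w} : G ⊩ isNat w -> G ⊩ ∃ E,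
  (∀ e, isEmpty e ⇒ e ∈ E) ∧ (∀ n, n ∈ w ⇒ n ∈ E ∨ ¬ n ∈ E) ∧
  (∀ n m, n ∈ w ⇒ isSucc m n ⇒ (m ∈ E ⇔ ¬ n ∈ E)).
Proof.
  intro Hw; obtain t Ht from two_exists; obtain e0 He0 from empty_exists.
  obtain o Ho from one_exists.
  have (e0 ∈ t) as te0 by apply (iff2 (Ht e0)), orI1, He0.
  have (o ∈ t) as to by apply (iff2 (Ht o)), orI2, Ho.
  have (¬ e0 ≐ o) as ne. { hi E; rwi E He0; exact (isOne_not_empty Ho He0). }
  have (∀ x, x ∈ t ⇒ x ≐ e0 ∨ x ≐ o) as tdec.
  { hi x Hx; cases (iff1 (Ht x) Hx) as K | K;
      [apply orI1; exact (isEmpty_unique K He0)|apply orI2; exact (isOne_unique K Ho)]. }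
  relate t t (fun x y => ¬ x ≐ y) as c [Hc Ec].
  have (isFun c t t) as Fc.
  { apply (isFunI Hc).
    - hi x Hx; cases (tdec x · Hx) as E | E.
      + apply exI with o, (iff2 (Ec x o)); splits; trivial; rw E; exact ne.
      + apply exI with e0, (iff2 (Ec x e0)); splits; trivial; rw E; hi E'.
        exact (ne · teq_sym E').
    - hi x y y' K K'; destruct (iff1 (Ec x y) K) as (Hx & Hy & N).
      destruct (iff1 (Ec x y') K') as (_ & Hy' & N').
      cases (tdec x · Hx) as E | E; rwi E N; rwi E N';
        cases (tdec y · Hy) as F | F; cases (tdec y' · Hy') as F' | F';
        rw F; rw F'; solve [apply teq_refl | absurd_by (N · teq_sym F)
                           | absurd_by (N' · teq_sym F')]. }
  obtain s (Hs & H0 & HS) from (orbit_exists Hw Fc te0).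
  separate w (fun n => rel s n e0) as E HE.
  have (∀ n, n ∈ w ⇒ n ∈ E ∨ rel s n o) as D.
  { hi n Hn; obtain v [Hv K] from (isFun_total Hs Hn).
    cases (tdec v · Hv) as F | F; rwi F K; [apply orI1|apply orI2, K].
    apply (iff2 (HE n)); split; trivial. }
  have (∀ n, n ∈ E ⇒ ¬ rel s n o) as D'.
  { hi n Hn K; exact (ne · isFun_unique Hs (proj2 (iff1 (HE n) Hn)) K). }
  apply exI with E; splits.
  - hi e He; apply (iff2 (HE e)); split; [exact (zero_in_nat Hw He)|].
    obtain e' [He' K] from H0; rw (isEmpty_unique He He'); exact K.
  - hi n Hn; cases (D n · Hn) as K | K; [apply orI1, K|apply orI2].
    hi K'; exact (D' n · K' · K).
  - hi n m Hn Hm; pose proof (succ_in_nat Hw Hn Hm) as Hm'.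
    pose proof (((HS n · Hn) m · Hm') · Hm) as R; hiff K.
    + hi K'; pose proof (R e0 e0 · proj2 (iff1 (HE n) K') · proj2 (iff1 (HE m) K)) as C.
      exact (proj2 (proj2 (iff1 (Ec e0 e0) C)) · teq_refl e0).
    + cases (D n · Hn) as L | L; [absurd_by (K · L)|].
      cases (D m · Hm') as M | M; [exact M|].
      absurd_by (proj2 (proj2 (iff1 (Ec o o) (R o o · L · M))) · teq_refl o).
Qed.

Lemma isRestriction_rel {G k h A x y} : G ⊩ isRestriction k h A -> G ⊩ rel k x y -> G ⊩ rel h x y.
Proof.
  intros H K; obtain z [Hz K'] from K; apply exI with z; split; trivial.
  exact (proj1 (iff1 (H z) Hz)).
Qed.

(** The common core of the sum and the product. The last hypothesis decides, for each element of
    [X], whether it is in the image of [i], in [q] or in the rest; inhabitedness of [q] itself is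
    not presupposed. *)
Lemma myhill_decides {G w X i q} : G ⊩ lpo -> G ⊩ isNat w -> G ⊩ myhill X ->
  G ⊩ isInj i w X -> G ⊩ sub q X -> G ⊩ (∀ x y, x ∈ q ⇒ y ∈ q ⇒ x ≐ y) ->
  G ⊩ (∀ n x, rel i n x ⇒ ¬ x ∈ q) ->
  G ⊩ (∀ x, x ∈ X ⇒ (∃ n, rel i n x) ∨ x ∈ q ∨ (∀' n ∈ w, ¬ rel i n x) ∧ ¬ x ∈ q) ->
  G ⊩ (∃ x, x ∈ q) ∨ ¬ (∃ x, x ∈ q).
Proof.
  intros Hlpo Hw HM [Fi Ii] qX qsub iq tri.
  obtain E (E0 & Edec & ES) from (parity_exists Hw); obtain e He from empty_exists.
  pose proof (zero_in_nat Hw He) as He'.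
  obtain i0 [Hi0 Li0] from (isFun_total Fi He').
  relate X X (fun x y => (∃' n ∈ w, ∃' m ∈ w, isSucc m n ∧ rel i n x ∧ rel i m y) ∨
    (x ∈ q ∧ rel i e y) ∨ ((∀' n ∈ w, ¬ rel i n x) ∧ ¬ x ∈ q ∧ x ≐ y)) as f [Hf Ef].
  have (∀ x y, rel f x y ⇒ (∃ n, ∃ m, isSucc m n ∧ rel i n x ∧ rel i m y) ∨
    (x ∈ q ∧ rel i e y) ∨ ((∀ n, ¬ rel i n x) ∧ ¬ x ∈ q ∧ x ≐ y)) as fE.
  { hi x y K; cases (proj2 (proj2 (iff1 (Ef x y) K))) as A | A.
    - apply orI1; obtain n [Hn A1] from A; obtain m [Hm A2] from A1.
      apply exI with n, exI with m, A2.
    - apply orI2; cases A as B | B; [apply orI1, B|apply orI2].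
      destruct B as [B1 B2]; split; trivial; hi n K'.
      exact (B1 n · proj1 (isFun_dom Fi K') · K'). }
  have (∀ n m x y, isSucc m n ⇒ rel i n x ⇒ rel i m y ⇒ rel f x y) as f1.
  { hi n m x y Hm L L'; destruct (isFun_dom Fi L) as [Hn Hx], (isFun_dom Fi L') as [Hm' Hy].
    apply (iff2 (Ef x y)); splits; trivial; apply orI1, exI with n; split; trivial.
    apply exI with m; splits; trivial. }
  have (∀ x, x ∈ q ⇒ rel f x i0) as f2.
  { hi x Hx; apply (iff2 (Ef x i0)); splits; trivial; [exact (qX x · Hx)|].
    apply orI2, orI1; split; trivial. }
  (* Each of the three clauses is injective, and their images are the points i(n + 1), the point
     i(0) and the rest, which are pairwise disjoint. *)
  have (isInj f X X) as Jf.
  { split; [apply (isFunI Hf)|].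
    - hi x Hx; cases (tri x · Hx) as K | K.
      + obtain n L from K; destruct (isFun_dom Fi L) as [Hn _].
        obtain m Hm from (succ_of n); pose proof (succ_in_nat Hw Hn Hm) as Hm'.
        obtain y [_ L'] from (isFun_total Fi Hm'); apply exI with y.
        exact (f1 n m x y · Hm · L · L').
      + cases K as K' | K'; [apply exI with i0; exact (f2 x · K')|].
        apply exI with x, (iff2 (Ef x x)); splits; trivial.
        apply orI2, orI2; destruct K'; splits; trivial; apply teq_refl.
    - hi x y y' K K'; cases (fE x y · K) as A | A.
      + obtain n A1 from A; obtain m (Hm & L & L1) from A1; cases (fE x y' · K') as B | B.
        * obtain n' B1 from B; obtain m' (Hm' & L' & L1') from B1.
          rwi (Ii n n' x · L · L') Hm; rwi (isSucc_unique Hm Hm') L1.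
          exact (isFun_unique Fi L1 L1').
        * cases B as [B1 _] | [B1 _]; [absurd_by (iq n x · L · B1)|absurd_by (B1 n · L)].
      + cases A as [A1 A2] | (A1 & A2 & A3); cases (fE x y' · K') as B | B.
        * obtain n B' from B; obtain m (_ & L & _) from B'; absurd_by (iq n x · L · A1).
        * cases B as [_ B1] | (_ & B1 & _); [exact (isFun_unique Fi A2 B1)|absurd_by (B1 · A1)].
        * obtain n B' from B; obtain m (_ & L & _) from B'; absurd_by (A1 n · L).
        * cases B as [B1 _] | (_ & _ & B1); [absurd_by (A2 · B1)|].
          exact (teq_trans (teq_sym A3) B1).
    - hi x x' y K K'; cases (fE x y · K) as A | A.
      + obtain n A1 from A; obtain m (Hm & L & L1) from A1; cases (fE x' y · K') as B | B.
        * obtain n' B1 from B; obtain m' (Hm' & L' & L1') from B1.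
          rwi (Ii m m' y · L1 · L1') Hm.
          rwi (succ_inj Hw (proj1 (isFun_dom Fi L)) (proj1 (isFun_dom Fi L')) Hm Hm') L.
          exact (isFun_unique Fi L L').
        * cases B as [_ B1] | (B1 & _ & B2).
          -- rwi (Ii m e y · L1 · B1) Hm; absurd_by (isSucc_not_empty Hm He).
          -- rwi (teq_sym B2) L1; absurd_by (B1 m · L1).
      + cases A as [A1 A2] | (A1 & A2 & A3); cases (fE x' y · K') as B | B.
        * obtain n B' from B; obtain m (Hm & _ & L) from B'.
          rwi (Ii m e y · L · A2) Hm; absurd_by (isSucc_not_empty Hm He).
        * cases B as [B1 _] | (B1 & _ & B2); [exact (qsub x x' · A1 · B1)|].
          rwi (teq_sym B2) A2; absurd_by (B1 e · A2).
        * obtain n B' from B; obtain m (_ & _ & L) from B'.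
          rwi (teq_sym A3) L; absurd_by (A1 m · L).
        * cases B as [_ B1] | (_ & _ & B1).
          -- rwi (teq_sym A3) B1; absurd_by (A1 e · B1).
          -- exact (teq_trans A3 (teq_sym B1)). }
  (* [A] consists of [q] and the odd points of the copy of the natural numbers, [B] of its even
     points. *)
  separate X (fun x => x ∈ q ∨ (∃' n ∈ w, ¬ n ∈ E ∧ rel i n x)) as A HA.
  separate X (fun x => ∃' n ∈ w, n ∈ E ∧ rel i n x) as B HB.
  have (isPreimage A f X B) as PA.
  { hi x; hiff K.
    - destruct (iff1 (HA x) K) as [Hx K']; split; trivial; cases K' as Q | Q.
      + apply exI with i0; split; [|exact (f2 x · Q)].
        apply (iff2 (HB i0)); split; trivial; apply exI with e; splits; trivial.
        exact (E0 e · He).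
      + obtain n (Hn & NE & L) from Q; obtain m Hm from (succ_of n).
        pose proof (succ_in_nat Hw Hn Hm) as Hm'; obtain y [Hy L'] from (isFun_total Fi Hm').
        apply exI with y; split; [|exact (f1 n m x y · Hm · L · L')].
        apply (iff2 (HB y)); split; trivial; apply exI with m; splits; trivial.
        exact (iff2 (ES n m · Hn · Hm) NE).
    - destruct K as [Hx K]; obtain y [Hy L] from K; apply (iff2 (HA x)); split; trivial.
      obtain k (Hk & KE & Lk) from (proj2 (iff1 (HB y) Hy)).
      cases (fE x y · L) as C | C.
      + obtain n C1 from C; obtain m (Hm & L1 & L2) from C1; apply orI2.
        pose proof (proj1 (isFun_dom Fi L1)) as Hn; apply exI with n; splits; trivial.
        apply (iff1 (ES n m · Hn · Hm)); rw (Ii m k y · L2 · Lk); exact KE.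
      + cases C as [C1 _] | (C1 & _ & C2); [apply orI1, C1|].
        rwi (teq_sym C2) Lk; absurd_by (C1 k · Lk). }
  (* No value of [f] lies in [q], so a value in [A] is an odd point. It cannot be i(0) or belong to
     the rest, so it is the shift of an even point. *)
  have (isPreimage B f X A) as PB.
  { hi x; hiff K.
    - destruct (iff1 (HB x) K) as [Hx Q]; split; trivial.
      obtain n (Hn & NE & L) from Q; obtain m Hm from (succ_of n).
      pose proof (succ_in_nat Hw Hn Hm) as Hm'; obtain y [Hy L'] from (isFun_total Fi Hm').
      apply exI with y; split; [|exact (f1 n m x y · Hm · L · L')].
      apply (iff2 (HA y)); split; trivial; apply orI2, exI with m; splits; trivial.
      hi ME; exact (iff1 (ES n m · Hn · Hm) ME · NE).
    - destruct K as [Hx K]; obtain y [Hy L] from K; apply (iff2 (HB x)); split; trivial.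
      cases (proj2 (iff1 (HA y) Hy)) as Q | Q.
      + cases (fE x y · L) as C | C.
        * obtain n C1 from C; obtain m (_ & _ & L2) from C1; absurd_by (iq m y · L2 · Q).
        * cases C as [_ C1] | (_ & C1 & C2); [absurd_by (iq e y · C1 · Q)|].
          rwi (teq_sym C2) Q; absurd_by (C1 · Q).
      + obtain k (Hk & KE & Lk) from Q; cases (fE x y · L) as C | C.
        * obtain n C1 from C; obtain m (Hm & L1 & L2) from C1.
          pose proof (proj1 (isFun_dom Fi L1)) as Hn; apply exI with n; splits; trivial.
          cases (Edec n · Hn) as D | D; [exact D|].
          refine (botE (KE · _)); rwi (Ii m k y · L2 · Lk) Hm; exact (iff2 (ES n k · Hn · Hm) D).
        * cases C as [_ C1] | (C1 & _ & C2).
          -- refine (botE (KE · _)); rwi (Ii e k y · C1 · Lk) He; exact (E0 k · He).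
          -- rwi (teq_sym C2) Lk; absurd_by (C1 k · Lk). }
  have (sub A X) as SA. { hi z Hz; exact (proj1 (iff1 (HA z) Hz)). }
  have (sub B X) as SB. { hi z Hz; exact (proj1 (iff1 (HB z) Hz)). }
  obtain h [[[_ Ih] _] K] from ((HM A B · SA · SB) f f · Jf · Jf · PA · PB).
  obtain k [Rk [[Fk _] Sk]] from K.
  (* For even [n], i(n) is in [B] and has a preimage in [A]; being an element of [A], the preimage
     is either in [q] or an odd point, which makes the predicate decidable. *)
  search Hlpo Hw (fun n => n ∈ E ∧ (∃' x ∈ q, ∃' y ∈ X, rel i n y ∧ rel h x y)) as H.
  - hi n Hn; cases (Edec n · Hn) as D | D; [|apply orI2; hi M; exact (D · proj1 M)].
    obtain y [Hy L] from (isFun_total Fi Hn).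
    have (y ∈ B) as HyB.
    { apply (iff2 (HB y)); split; trivial; apply exI with n; splits; trivial. }
    obtain a [Ha La] from (Sk y · HyB); pose proof (isRestriction_rel Rk La) as La'.
    cases (proj2 (iff1 (HA a) Ha)) as Q | Q.
    + apply orI1; split; trivial; apply exI with a; split; trivial.
      apply exI with y; splits; trivial.
    + apply orI2; hi M; obtain x [Qx M1] from (proj2 M); obtain y' (_ & N1 & N2) from M1.
      obtain m (_ & _ & L') from Q.
      rwi (isFun_unique Fi N1 L) N2; rwi (Ih x a y · N2 · La') Qx; exact (iq m a · L' · Qx).
  - cases H as D | D.
    + apply orI1; obtain n [_ [_ M]] from D; obtain x [Qx _] from M; now apply exI with x.
    (* An element of [q] would be in [A], so [h] would send it to some i(n) with [n] even, which the
       search would have found. *)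
    + apply orI2; hi M; obtain x Qx from M.
      have (x ∈ A) as Hx.
      { apply (iff2 (HA x)); split; [exact (qX x · Qx)|apply orI1, Qx]. }
      obtain y [Hy L] from (isFun_total Fk Hx).
      destruct (iff1 (HB y) Hy) as [HyX Q]; obtain n (Hn & NE & L') from Q.
      refine (D n · Hn · _); split; trivial; apply exI with x; split; trivial.
      apply exI with y; splits; trivial; exact (isRestriction_rel Rk L).
Qed.

(** * The sum and the product of the natural numbers with a subset of 2 *)

(** Here i(n) = (0, n), the only possible element of [q] is (1, 1), and the rest consists of (1,
    0). *)
Lemma sum_decides {G w t B S p} : G ⊩ lpo -> G ⊩ isNat w -> G ⊩ isTwo t ->
  G ⊩ (∀ z, z ∈ B ⇔ z ∈ t ∧ (isEmpty z ∨ inhabited p)) ->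
  G ⊩ isSum S w B -> G ⊩ myhill S -> G ⊩ inhabited p ∨ ¬ inhabited p.
Proof.
  intros Hlpo Hw Ht HB HS HM.
  obtain e He from empty_exists; obtain o Ho from one_exists.
  have (¬ e ≐ o) as ne. { hi E; rwi E He; exact (isOne_not_empty Ho He). }
  relate w S (fun n x => isPair x e n) as i [Hi Ei].
  separate S (fun x => isPair x o o) as q Hq.
  have ((∃ x, x ∈ q) ⇔ inhabited p) as Qp.
  { hiff K.
    - obtain x Hx from K; destruct (iff1 (Hq x) Hx) as [HxS Px].
      cases (iff1 (HS x) HxS) as L | L.
      + obtain a [_ L1] from L; obtain z [Hz L2] from L1.
        destruct (isPair_inj L2 Px) as [E _]; rwi E Hz; absurd_by (isOne_not_empty Ho Hz).
      + obtain b [Hb L1] from L; obtain z [_ L2] from L1.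
        destruct (isPair_inj L2 Px) as [_ E]; rwi E Hb.
        cases (proj2 (iff1 (HB o) Hb)) as M | M; [absurd_by (isOne_not_empty Ho M)|exact M].
    - obtain x Hx from (pair_exists o o); apply exI with x, (iff2 (Hq x)); split; trivial.
      apply (iff2 (HS x)), orI2, exI with o; split; [|apply exI with o; split; trivial].
      apply (iff2 (HB o)); split; [apply (iff2 (Ht o)), orI2, Ho|apply orI2, K]. }
  have ((∃ x, x ∈ q) ∨ ¬ (∃ x, x ∈ q)) as D.
  { apply (myhill_decides (i := i) Hlpo Hw HM).
    - split; [apply (isFunI Hi)|].
      + hi n Hn; obtain x Hx from (pair_exists e n); apply exI with x, (iff2 (Ei n x)).
        splits; trivial; apply (iff2 (HS x)), orI1, exI with n; split; trivial.
        apply exI with e; split; trivial.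
      + hi n x x' K K'.
        exact (isPair_unique (proj2 (proj2 (iff1 (Ei n x) K)))
                             (proj2 (proj2 (iff1 (Ei n x') K')))).
      + hi n n' x K K'.
        exact (proj2 (isPair_inj (proj2 (proj2 (iff1 (Ei n x) K)))
                                 (proj2 (proj2 (iff1 (Ei n' x) K'))))).
    - hi x Hx; exact (proj1 (iff1 (Hq x) Hx)).
    - hi x y Hx Hy.
      exact (isPair_unique (proj2 (iff1 (Hq x) Hx)) (proj2 (iff1 (Hq y) Hy))).
    - hi n x K Hx; destruct (isPair_inj (proj2 (proj2 (iff1 (Ei n x) K)))
        (proj2 (iff1 (Hq x) Hx))) as [E _]; exact (ne · E).
    - hi x Hx; cases (iff1 (HS x) Hx) as L | L.
      + obtain n [Hn L1] from L; obtain z [Hz L2] from L1; rwi (isEmpty_unique Hz He) L2.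
        apply orI1, exI with n, (iff2 (Ei n x)); splits; trivial.
      + apply orI2; obtain b [Hb L1] from L; obtain z [Hz L2] from L1.
        rwi (isOne_unique Hz Ho) L2; cases (iff1 (Ht b) (proj1 (iff1 (HB b) Hb))) as V | V.
        * apply orI2; split.
          -- hi n Hn K; destruct (isPair_inj (proj2 (proj2 (iff1 (Ei n x) K))) L2) as [E _].
             exact (ne · E).
          -- hi K; destruct (isPair_inj (proj2 (iff1 (Hq x) K)) L2) as [_ E].
             rwi (teq_sym E) V; exact (isOne_not_empty Ho V).
        * apply orI1, (iff2 (Hq x)); split; trivial; rwi (isOne_unique V Ho) L2; exact L2. }
  cases D as K | K; [apply orI1; exact (iff1 Qp K)|apply orI2].
  hi M; exact (K · iff2 Qp M).
Qed.

(** Here i(n) = (n, 0), the only possible element of [q] is (0, 1), and the rest consists of the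
    pairs (m + 1, 1), which are present only if [p] holds. Comparing the first component with 0
    separates [q] from the rest. *)
Lemma product_decides {G w t B P p} : G ⊩ lpo -> G ⊩ isNat w -> G ⊩ isTwo t ->
  G ⊩ (∀ z, z ∈ B ⇔ z ∈ t ∧ (isEmpty z ∨ inhabited p)) ->
  G ⊩ isProd P w B -> G ⊩ myhill P -> G ⊩ inhabited p ∨ ¬ inhabited p.
Proof.
  intros Hlpo Hw Ht HB HP HM.
  obtain e He from empty_exists; obtain o Ho from one_exists.
  have (¬ e ≐ o) as ne. { hi E; rwi E He; exact (isOne_not_empty Ho He). }
  have (e ∈ B) as HeB.
  { apply (iff2 (HB e)); split; [apply (iff2 (Ht e))|]; apply orI1, He. }
  relate w P (fun n x => isPair x n e) as i [Hi Ei].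
  separate P (fun x => isPair x e o) as q Hq.
  have ((∃ x, x ∈ q) ⇔ inhabited p) as Qp.
  { hiff K.
    - obtain x Hx from K; destruct (iff1 (Hq x) Hx) as [HxP Px].
      obtain a [_ L1] from (iff1 (HP x) HxP); obtain b [Hb L2] from L1.
      destruct (isPair_inj L2 Px) as [_ E]; rwi E Hb.
      cases (proj2 (iff1 (HB o) Hb)) as M | M; [absurd_by (isOne_not_empty Ho M)|exact M].
    - obtain x Hx from (pair_exists e o); apply exI with x, (iff2 (Hq x)); split; trivial.
      apply (iff2 (HP x)), exI with e; split; [exact (zero_in_nat Hw He)|].
      apply exI with o; split; trivial.
      apply (iff2 (HB o)); split; [apply (iff2 (Ht o)), orI2, Ho|apply orI2, K]. }
  have ((∃ x, x ∈ q) ∨ ¬ (∃ x, x ∈ q)) as D.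
  { apply (myhill_decides (i := i) Hlpo Hw HM).
    - split; [apply (isFunI Hi)|].
      + hi n Hn; obtain x Hx from (pair_exists n e); apply exI with x, (iff2 (Ei n x)).
        splits; trivial; apply (iff2 (HP x)), exI with n; split; trivial.
        apply exI with e; split; trivial.
      + hi n x x' K K'.
        exact (isPair_unique (proj2 (proj2 (iff1 (Ei n x) K)))
                             (proj2 (proj2 (iff1 (Ei n x') K')))).
      + hi n n' x K K'.
        exact (proj1 (isPair_inj (proj2 (proj2 (iff1 (Ei n x) K)))
                                 (proj2 (proj2 (iff1 (Ei n' x) K'))))).
    - hi x Hx; exact (proj1 (iff1 (Hq x) Hx)).
    - hi x y Hx Hy.
      exact (isPair_unique (proj2 (iff1 (Hq x) Hx)) (proj2 (iff1 (Hq y) Hy))).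
    - hi n x K Hx; destruct (isPair_inj (proj2 (proj2 (iff1 (Ei n x) K)))
        (proj2 (iff1 (Hq x) Hx))) as [_ E]; exact (ne · E).
    - hi x Hx; obtain n [Hn L1] from (iff1 (HP x) Hx); obtain b [Hb L] from L1.
      cases (iff1 (Ht b) (proj1 (iff1 (HB b) Hb))) as V | V.
      + rwi (isEmpty_unique V He) L.
        apply orI1, exI with n, (iff2 (Ei n x)); splits; trivial.
      + apply orI2; rwi (isOne_unique V Ho) L; cases ((zero_or_succ Hw n) · Hn) as Z | Z.
        * apply orI1, (iff2 (Hq x)); split; trivial; rwi (isEmpty_unique Z He) L; exact L.
        * apply orI2; split.
          -- hi n' Hn' K; destruct (isPair_inj (proj2 (proj2 (iff1 (Ei n' x) K))) L) as [_ E].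
             exact (ne · E).
          -- hi K; destruct (isPair_inj (proj2 (iff1 (Hq x) K)) L) as [E _].
             obtain m [_ Hm] from Z; rwi E He; exact (isSucc_not_empty Hm He). }
  cases D as K | K; [apply orI1; exact (iff1 Qp K)|apply orI2].
  hi M; exact (K · iff2 Qp M).
Qed.

(** * Excluded middle *)

Lemma forces_excludedMiddle G : G ⊩ lpo ⇒ myhillClosure ⇒ excludedMiddle.
Proof.
  hi Hlpo HC o Ho p Hp.
  obtain w Hw from nat_exists; obtain t Ht from two_exists.
  separate t (fun z => isEmpty z ∨ inhabited p) as B HB.
  cases (HC w B · nat_strongMyhill Hlpo Hw · subtwo_strongMyhill Ht HB) as K | K.
  - obtain S [HS HM] from K; exact (sum_decides Hlpo Hw Ht HB HS HM).
  - obtain P [HP HM] from K; exact (product_decides Hlpo Hw Ht HB HP HM).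
Qed.

Close Scope tv_scope.

(* Unfolding the connectives would make the conversion in the proof below blow up. *)
Opaque tand tor timp tall tex tmem teq tbot.

Theorem corollary28 :
  provable
    (LPO ⇒
     (∀ A B, StrongMyhill A ⇒ StrongMyhill B ⇒
        (∃ S, IsSum S A B ∧ Myhill S) ∨ (∃ P, IsProd P A B ∧ Myhill P)) ⇒
     ExcludedMiddle).
Proof.
  apply provable_of_forces.
  - exact forces_excludedMiddle.
  (* The sentence is closed, so every index meets [r] only below enough binders and the renaming
     computes away although [r] is a variable. *)
  - intro r; vm_compute; reflexivity.
Qed.
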